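(* Let $(U,\mathrm{dist})$ be a metric space of doubling dimension $D$, let $S\subseteq U$ be a finite set with aspect ratio $\Delta$, let $M=(S,I)$ be a matroid on $S$ accessible through a constant-time independence oracle, and let $\epsilon>0$. There is an algorithm that, given an augmented cover tree $T$ for $S$ with respect to $M$ (in explicit representation) and $\epsilon$, returns an independent set $C\in I$ with $r_C(S)\le(3+O(\epsilon))\,r^*(M)$, in time $O\big(\mathrm{poly}(\mathrm{rank}(M),(64/\epsilon)^D)+\mathrm{rank}(M)\log\Delta\big)$.
   Context: The doubling dimension of $(U,\mathrm{dist})$ is the minimum $D\ge0$ such that every ball $B(p,r)=\{q\in U:\mathrm{dist}(p,q)\le r\}$ is contained in the union of at most $2^D$ balls of radius $r/2$ centered at points of $U$. The aspect ratio of $S$ is $\Delta=d_{\max}/d_{\min}$, the ratio of the maximum and minimum distances between two distinct points of $S$. For $C\subseteq S$, $r_C(S)=\max_{p\in S}\min_{q\in C}\mathrm{dist}(p,q)$. The matroid center problem on $M=(S,I)$ asks for $C\in I$ minimizing $r_C(S)$; $r^*(M)=\min_{C\in I}r_C(S)$. $\mathrm{rank}(M)$ is the common size of the maximal independent sets of $M$. A cover tree $T$ for $S$ is a rooted tree with levels indexed by integers decreasing from the root; $T_\ell$ is the set of nodes at level $\ell$, each node $u$ is associated with a point $u.\mathrm{point}\in S$, the points of the nodes of $T_\ell$ are distinct, and every non-root node of $T_\ell$ has a parent in $T_{\ell+1}$. Writing $\mathrm{dist}(u,v)=\mathrm{dist}(u.\mathrm{point},v.\mathrm{point})$, for every level $\ell$: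 (1) the points of $T_\ell$ are contained in the points of $T_{\ell-1}$; (2) $\mathrm{dist}(u,u.\mathrm{parent})\le 2^{\ell+1}$ for $u\in T_\ell$; (3) $\mathrm{dist}(u,v)>2^\ell$ for distinct $u,v\in T_\ell$. In the explicit representation, maximal chains of same-point nodes each having only the same-point child are coalesced into a single node. An augmented cover tree for $S$ with respect to $M$ stores at each node $u$ the value $u.\mathrm{weight}=|S_u|$ and a maximal independent set $u.\mathrm{mis}$ of the restriction of $M$ to $S_u$, where $S_u$ is the set of points associated with nodes in the subtree rooted at $u$. *)

(* Defs.v *)
From Stdlib Require List.
From HB Require Import structures.
From mathcomp Require Import all_boot all_order all_algebra finmap.
From mathcomp Require Import all_classical all_reals all_analysis.

Set Implicit Arguments.
Unset Strict Implicit.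
Unset Printing Implicit Defensive.

Import Order.TTheory GRing.Theory Num.Theory.
Local Open Scope fset_scope.
Local Open Scope ring_scope.

(* The library's [closed_ball] is the closure of the open ball, which may be
   strictly smaller than this set. *)
Definition cball (R : realType) (U : metricType R) (p : U) (r : R) : set U :=
  [set q | mdist p q <= r]%classic.

Definition doubling_bound (R : realType) (U : metricType R) (D : R) : Prop :=
  forall (p : U) (r : R), exists cs : seq U,
    (size cs)%:R <= 2 `^ D /\
    (forall q, cball p r q -> exists2 c, c \in cs & cball c (r / 2) q).

Definition doubling_dimension (R : realType) (U : metricType R) (D : R) : Prop :=
  [/\ 0 <= D, doubling_bound U D &
      forall D', 0 <= D' -> doubling_bound U D' -> D <= D'].

Definition max_dist (R : realType) (U : metricType R) (S : {fset U}) : R :=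
  \big[Num.max/0]_(p <- S) \big[Num.max/0]_(q <- S) mdist p q.

(* [max_dist S] serves only as a neutral element: it bounds all distances. *)
Definition min_dist (R : realType) (U : metricType R) (S : {fset U}) : R :=
  \big[Num.min/max_dist S]_(p <- S)
    \big[Num.min/max_dist S]_(q <- S | q != p) mdist p q.

(* If [S] is a singleton this is [0 / 0 = 0], whose [ln] is [0]. *)
Definition aspect_ratio (R : realType) (U : metricType R) (S : {fset U}) : R :=
  max_dist S / min_dist S.

Record matroid (U : choiceType) (S : {fset U}) := Matroid {
  indep : pred {fset U};
  indep_sub : forall A, indep A -> A `<=` S;
  indep0 : indep fset0;
  indep_subset : forall A B, A `<=` B -> indep B -> indep A;
  indep_exchange : forall A B, indep A -> indep B -> (#|` A| < #|` B|)%N ->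
    exists2 x, x \in B `\` A & indep (x |` A) }.

(* [A] is a maximal independent set of the restriction of [M] to [X]. *)
Definition max_indep (U : choiceType) (S : {fset U}) (M : matroid S)
    (X A : {fset U}) : Prop :=
  [/\ A `<=` X, indep M A &
      forall B, B `<=` X -> indep M B -> A `<=` B -> B = A].

Definition matroid_rank (U : choiceType) (S : {fset U}) (M : matroid S)
    (k : nat) : Prop :=
  forall A, max_indep M S A -> #|` A| = k.

(* Extended reals, so that an empty set of centers has radius [+oo]. *)
Definition cover_radius (R : realType) (U : metricType R) (S C : {fset U})
    : \bar R :=
  \big[maxe/-oo%E]_(p <- S) \big[mine/+oo%E]_(q <- C) (mdist p q)%:E.

Definition opt_radius (R : realType) (U : metricType R) (S : {fset U})
    (M : matroid S) : \bar R :=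
  \big[mine/+oo%E]_(C <- fpowerset S | indep M C) cover_radius S C.

(* Points of the nodes of a level being distinct, the node of level [l] with
   point [p] is represented by the pair [(l, p)]; [ct_points T l] is the set of
   points of the nodes of level [l], and [ct_parent T l p] is the point of the
   parent (at level [l + 1]) of the node [(l, p)].  Levels extend indefinitely
   below the root. *)
Record cover_tree (U : choiceType) := CoverTree {
  ct_root_level : int;
  ct_root : U;
  ct_points : int -> {fset U};
  ct_parent : int -> U -> U }.

Definition is_cover_tree (R : realType) (U : metricType R) (S : {fset U})
    (T : cover_tree U) : Prop :=
  (ct_points T (ct_root_level T) = [fset ct_root T]) /\
  (forall l, ct_root_level T < l -> ct_points T l = fset0) /\
  (forall l, ct_points T l `<=` S) /\
  (forall p, p \in S -> exists l, p \in ct_points T l) /\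
  (forall l p, l < ct_root_level T -> p \in ct_points T l ->
     ct_parent T l p \in ct_points T (l + 1)) /\
  (forall l, ct_points T l `<=` ct_points T (l - 1)) /\
  (forall l p, l < ct_root_level T -> p \in ct_points T l ->
     mdist p (ct_parent T l p) <= 2 ^ (l + 1)) /\
  (forall l p q, p \in ct_points T l -> q \in ct_points T l -> p != q ->
     2 ^ l < mdist p q).

Definition ct_children (U : choiceType) (T : cover_tree U) (l : int) (p : U)
    : {fset U} :=
  [fset q in ct_points T (l - 1) | ct_parent T (l - 1) q == p].

(* Explicit trees, as stored in memory: point, level, weight, maximal
   independent set, children. *)
Inductive etree (U : Type) : Type :=
  ENode of U & int & nat & seq U & seq (etree U).

Definition epoint (U : Type) (t : etree U) := let: ENode p _ _ _ _ := t in p.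
Definition elevel (U : Type) (t : etree U) := let: ENode _ l _ _ _ := t in l.
Definition eweight (U : Type) (t : etree U) := let: ENode _ _ w _ _ := t in w.
Definition emis (U : Type) (t : etree U) := let: ENode _ _ _ m _ := t in m.
Definition echildren (U : Type) (t : etree U) :=
  let: ENode _ _ _ _ cs := t in cs.

(* [explicit_from T l p t]: [t] is an explicit form of the subtree of [T]
   rooted at [(l, p)], where [(l, p)] is the top of a maximal coalesced chain.
   The explicit node records the top level [l] of its chain; the chain either
   goes down forever (a leaf), or stops at the first level [b] where [(b, p)]
   has a child with another point.  The order of the children is arbitrary.
   Weights and independent sets are not constrained here. *)
Inductive explicit_from (U : choiceType) (T : cover_tree U)
    : int -> U -> etree U -> Prop :=
| explicit_leaf l p w m :
    (forall j, j <= l -> ct_children T j p = [fset p]) ->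
    explicit_from T l p (ENode p l w m [::])
| explicit_branch l b p w m cs :
    b <= l ->
    (forall j, b < j -> j <= l -> ct_children T j p = [fset p]) ->
    ct_children T b p != [fset p] ->
    perm_eq [seq epoint c | c <- cs] (ct_children T b p) ->
    (forall c, List.In c cs -> explicit_from T (b - 1) (epoint c) c) ->
    explicit_from T l p (ENode p l w m cs).

Definition explicit_representation (U : choiceType) (T : cover_tree U)
    (t : etree U) : Prop :=
  explicit_from T (ct_root_level T) (ct_root T) t.

Fixpoint subtree_points (U : choiceType) (t : etree U) : {fset U} :=
  let: ENode p _ _ _ cs := t in
  foldr (fun c A => subtree_points c `|` A) [fset p] cs.

Inductive node_of (U : Type) : etree U -> etree U -> Prop :=
| node_of_root t : node_of t t
| node_of_child u c t : List.In c (echildren t) -> node_of u c -> node_of u t.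

Definition augmented (U : choiceType) (S : {fset U}) (M : matroid S)
    (t : etree U) : Prop :=
  forall u, node_of u t ->
    [/\ eweight u = #|` subtree_points u|, uniq (emis u) &
        max_indep M (subtree_points u) [fset x in emis u]].

(* Model of computation.

   A unit-cost real RAM with pointers, presented as an untyped call-by-value
   functional language.  A program is a closed piece of syntax that mentions
   neither the metric space nor the matroid: it accesses points only through
   the distance primitive and the independence oracle.

   Each evaluation rule charges one time unit on top of the cost of its
   premises and stands for O(1) RAM operations: values are immutable heap cells
   handled by reference, environments are linked lists, and the variable lookup
   of [eval_var] visits a number of cells bounded by the size of the program.
   On integers only addition, subtraction, comparison and the embedding into the
   reals are available; on reals, the field operations and comparison, but
   neither rounding nor any transcendental function. *)

Inductive prim1 : Type :=
| PRealOfInt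
| PIndep
| PPoint | PLevel | PWeight | PMis | PChildren.

Inductive prim2 : Type :=
| PAddI | PSubI | PLeI
| PAddR | PSubR | PMulR | PDivR | PLeR
| PDist.

(* De Bruijn indices.  [TFun b] is a recursive function: in [b], variable 0 is
   the argument and variable 1 the function itself.  In [TCase e e1 e2], the
   branch [e2] for cells sees the head as variable 0 and the tail as variable 1.
   Cells are also used as pairs. *)
Inductive term : Type :=
| TVar of nat
| TInt of int
| TBool of bool
| TNil
| TCons of term & term
| TCase of term & term & term
| TIf of term & term & term
| TLet of term & term
| TFun of term
| TApp of term & term
| TPrim1 of prim1 & term
| TPrim2 of prim2 & term & term.

Inductive value (R U : Type) : Type :=
| VInt of int
| VReal of R
| VBool of bool
| VPoint of U
| VTree of etree U
| VNil
| VCons of value R U & value R U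
| VClos of seq (value R U) & term.

Arguments VInt {R U}.
Arguments VReal {R U}.
Arguments VBool {R U}.
Arguments VPoint {R U}.
Arguments VTree {R U}.
Arguments VNil {R U}.
Arguments VCons {R U}.
Arguments VClos {R U}.

Definition vlist (R U : Type) (vs : seq (value R U)) : value R U :=
  foldr VCons VNil vs.

Definition vpoints (R U : Type) (s : seq U) : value R U :=
  vlist [seq VPoint p | p <- s].

Fixpoint points_of_value (R U : Type) (v : value R U) : option (seq U) :=
  match v with
  | VNil => Some [::]
  | VCons (VPoint p) v' => omap (cons p) (points_of_value v')
  | _ => None
  end.

(* Dynamic type errors yield [None], i.e. the evaluation is stuck. *)
Definition prim1_sem (R : realType) (U : metricType R) (oracle : pred {fset U})
    (o : prim1) (v : value R U) : option (value R U) :=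
  match o, v with
  | PRealOfInt, VInt z => Some (VReal z%:~R)
  | PIndep, _ =>
      omap (fun s => VBool (oracle [fset x in s])) (points_of_value v)
  | PPoint, VTree t => Some (VPoint (epoint t))
  | PLevel, VTree t => Some (VInt (elevel t))
  | PWeight, VTree t => Some (VInt (eweight t)%:Z)
  | PMis, VTree t => Some (vpoints R (emis t))
  | PChildren, VTree t => Some (vlist [seq VTree c | c <- echildren t])
  | _, _ => None
  end.

Definition prim2_sem (R : realType) (U : metricType R)
    (o : prim2) (v w : value R U) : option (value R U) :=
  match o, v, w with
  | PAddI, VInt x, VInt y => Some (VInt (x + y))
  | PSubI, VInt x, VInt y => Some (VInt (x - y))
  | PLeI, VInt x, VInt y => Some (VBool (x <= y))
  | PAddR, VReal x, VReal y => Some (VReal (x + y))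
  | PSubR, VReal x, VReal y => Some (VReal (x - y))
  | PMulR, VReal x, VReal y => Some (VReal (x * y))
  | PDivR, VReal x, VReal y => if y == 0 then None else Some (VReal (x / y))
  | PLeR, VReal x, VReal y => Some (VBool (x <= y))
  | PDist, VPoint p, VPoint q => Some (VReal (mdist p q))
  | _, _, _ => None
  end.

(* [evaluates oracle env e v n]: in environment [env], [e] terminates with value [v]
   after [n] time units. *)
Inductive evaluates (R : realType) (U : metricType R) (oracle : pred {fset U})
    : seq (value R U) -> term -> value R U -> nat -> Prop :=
| eval_var env i v : onth env i = Some v -> evaluates oracle env (TVar i) v 1
| eval_int env z : evaluates oracle env (TInt z) (VInt z) 1
| eval_bool env b : evaluates oracle env (TBool b) (VBool b) 1
| eval_nil env : evaluates oracle env TNil VNil 1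
| eval_cons env e1 e2 v1 v2 n1 n2 :
    evaluates oracle env e1 v1 n1 -> evaluates oracle env e2 v2 n2 ->
    evaluates oracle env (TCons e1 e2) (VCons v1 v2) (n1 + n2).+1
| eval_case_nil env e e1 e2 v n n1 :
    evaluates oracle env e VNil n -> evaluates oracle env e1 v n1 ->
    evaluates oracle env (TCase e e1 e2) v (n + n1).+1
| eval_case_cons env e e1 e2 h t v n n2 :
    evaluates oracle env e (VCons h t) n -> evaluates oracle (h :: t :: env) e2 v n2 ->
    evaluates oracle env (TCase e e1 e2) v (n + n2).+1
| eval_if env e e1 e2 b v n m :
    evaluates oracle env e (VBool b) n ->
    evaluates oracle env (if b then e1 else e2) v m ->
    evaluates oracle env (TIf e e1 e2) v (n + m).+1
| eval_let env e1 e2 v1 v n1 n2 :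
    evaluates oracle env e1 v1 n1 -> evaluates oracle (v1 :: env) e2 v n2 ->
    evaluates oracle env (TLet e1 e2) v (n1 + n2).+1
| eval_fun env b : evaluates oracle env (TFun b) (VClos env b) 1
| eval_app env e1 e2 env' b v2 v n1 n2 n3 :
    evaluates oracle env e1 (VClos env' b) n1 ->
    evaluates oracle env e2 v2 n2 ->
    evaluates oracle (v2 :: VClos env' b :: env') b v n3 ->
    evaluates oracle env (TApp e1 e2) v (n1 + n2 + n3).+1
| eval_prim1 env o e v w n :
    evaluates oracle env e v n -> prim1_sem oracle o v = Some w ->
    evaluates oracle env (TPrim1 o e) w n.+1
| eval_prim2 env o e1 e2 v1 v2 w n1 n2 :
    evaluates oracle env e1 v1 n1 -> evaluates oracle env e2 v2 n2 ->
    prim2_sem o v1 v2 = Some w ->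
    evaluates oracle env (TPrim2 o e1 e2) w (n1 + n2).+1.

(* Main.v *)
Require Import Defs.
From Stdlib Require List.
From HB Require Import structures.
From mathcomp Require Import all_boot all_order all_algebra finmap.
From mathcomp Require Import all_classical all_reals all_analysis.
From mathcomp Require Import zify lra.

Set Implicit Arguments.
Unset Strict Implicit.
Unset Printing Implicit Defensive.

Import Order.TTheory GRing.Theory Num.Theory.
Local Open Scope fset_scope.
Local Open Scope ring_scope.

(* Let [k] be the rank and [r*] the optimal radius.  Descend the cover tree
   level by level as long as the level has at most [k] nodes.  If the next level
   [l] has more than [k] nodes, two of its points, at distance more than [2^l],
   share an optimal center, so that [2^l < 2 r*].  Descending about
   [log2 (1 / eps)] further levels gives at most [k (64 / eps)^(2 D)] nodes whose
   subtrees have radius at most [d = 8 eps r*].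

   The independent sets stored at these nodes form a coreset: replacing the
   optimal centers one by one by elements of the independent sets of their nodes
   keeps them independent and moves each of them by at most [2 d].  On the
   coreset, for every candidate radius [r], choose greedily heads at pairwise
   distance more than [2 r]; their balls of radius [r] are disjoint, and an
   independent transversal of these balls covers all points of the nodes within
   [3 r].  Such a transversal is found by augmentation: a shortest alternating
   path is shortened by one exchange at its end where the independent set can be
   extended, then searched again; if no path exists, Rado's condition fails.

   The first descent visits at most [log2 Delta + 2] levels, at a cost of [O(k)]
   each; everything else is polynomial.  When [eps >= 1] the second descent is
   empty, so that the cost does not depend on [D]. *)

(** * Matroids *)

Section Matroid.
Context (U : choiceType) (S : {fset U}) (M : matroid S).
Implicit Types (A B I X : {fset U}) (x y : U).

Lemma indep_extend A B :
  indep M A -> indep M B -> (#|` A| <= #|` B|)%N ->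
  exists J, [/\ indep M J, A `<=` J, J `<=` A `|` B & #|` J| = #|` B| ].
Proof.
move=> iA iB; move: {2}(#|` B| - #|` A|)%N (erefl (#|` B| - #|` A|)%N) => d.
elim: d A iA => [|d IH] A iA dE leAB.
  by exists A; split; rewrite ?fsubset_refl ?fsubsetUl //; lia.
have [|x /fsetDP[xB xA] ixA] := indep_exchange iA iB; first by lia.
have cA : #|` x |` A| = (#|` A|).+1 by rewrite cardfsU1 xA.
have [||J [iJ AJ JU cJ]] := IH _ ixA; try lia.
exists J; split=> //; first by apply: fsubset_trans AJ; exact: fsubsetU1.
apply: (fsubset_trans JU); rewrite -fsetUA; apply/fsubsetP => z.
by rewrite !inE => /or3P[/eqP->| |] => [|->|->]; rewrite ?xB ?orbT.
Qed.

Lemma max_indep_notin X A x :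
  max_indep M X A -> x \in X -> x \notin A -> ~~ indep M (x |` A).
Proof.
move=> [AX iA maxA] xX; apply: contraNN => ixA.
rewrite -(maxA (x |` A)) ?fset1U1 //; last exact: fsubsetU1.
by apply/fsubsetP => z; rewrite !inE => /orP[/eqP-> // | /(fsubsetP AX)].
Qed.

Lemma max_indep_proxy X A Y x :
  max_indep M Y A -> indep M X -> x \in X -> x \in Y ->
  exists y, [/\ y \in A, y \notin X `\ x & indep M (y |` (X `\ x))].
Proof.
move=> mA iX xX xY; have [AY iA _] := mA.
have iX' : indep M (X `\ x) by apply: indep_subset iX; rewrite fsubsetDl.
have cX : #|` X| = (#|` X `\ x|).+1 by rewrite (cardfsD1 x) xX.
have [ltA|leA] := ltnP #|` X `\ x| #|` A|.
  by have [y /fsetDP[]] := indep_exchange iX' iA ltA; exists y.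
have [J [iJ AJ JU cJ]] := indep_extend iA iX' leA.
have [|z /fsetDP[zX zJ] izJ] := indep_exchange iJ iX; first by rewrite cX cJ.
have izA : indep M (z |` A) by apply: indep_subset izJ; exact: fsetUS.
have zA : z \notin A by apply: contraNN zJ => /(fsubsetP AJ).
have zNx : z != x.
  apply: contraTneq izA => zx; rewrite zx in zA *.
  exact: max_indep_notin mA xY zA.
have [|y /fsetDP[yJ yX] iy] := indep_exchange iX' izJ.
  by rewrite cardfsU1 zJ cJ add1n.
exists y; split=> //; move: yJ; rewrite !inE => /orP[/eqP yz|yJ].
  by move: yX; rewrite yz !inE zNx zX.
by move/(fsubsetP JU): yJ; rewrite inE (negbTE yX) orbF.
Qed.

(* If [x1] is spanned by [I] only through [y], then swapping [y] for [x1] keeps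
   the span of [I], which does not contain [x0]. *)
Lemma indep_swap I x0 x1 y :
  y \in I -> x0 \notin I -> indep M (x0 |` I) ->
  x1 \notin I -> ~~ indep M (x1 |` I) -> indep M (x1 |` (I `\ y)) ->
  indep M (x1 |` (x0 |` (I `\ y))).
Proof.
move=> yI x0I ix0 x1I nx1 ix1.
have [|z] := indep_exchange ix1 ix0.
  rewrite !cardfsU1 x0I (cardfsD1 y I) yI.
  by rewrite in_fsetD1 (negbTE x1I) andbF.
case/fsetDP=> /fset1UP[->|zI] + iz; first by rewrite fsetUCA.
rewrite !inE negb_or zI andbT negbK => /andP[_ /eqP zy].
by move: iz; rewrite zy fsetUCA fsetD1K // (negbTE nx1).
Qed.

End Matroid.

(** * Independent transversals *)

Section TransversalSearch.
Context (U : eqType) (ind : pred (seq U)) (near : rel U) (H Q : seq U).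
Implicit Types (sg : seq (U * U)) (h x : U) (Z : seq U).

(* A state [sg] lists pairs (head, representative) for the heads served so
   far; the other heads are free. *)
Definition free_heads sg := [seq h <- H | h \notin unzip1 sg].

Definition others sg h := unzip2 [seq e <- sg | e.1 != h].

Definition candidates sg Z :=
  [seq e <- [seq (h, x) | h <- Z, x <- [seq x <- Q | x \notin unzip2 sg]]
     | near e.1 e.2].

Definition augmenting sg Z :=
  [seq e <- candidates sg Z | ind (e.2 :: unzip2 sg)].

Definition releasable sg Z :=
  [seq h <- H | (h \notin Z)
     && has (fun e => ind (e.2 :: others sg h)) (candidates sg Z)].

Definition grow sg Z :=
  if nilp (augmenting sg Z) then releasable sg Z ++ Z else Z.

Definition search sg := iter (size H) (grow sg) (free_heads sg).

Definition serve sg :=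
  if augmenting sg (search sg) is (h, x) :: _
  then (h, x) :: [seq e <- sg | e.1 != h] else sg.

Definition indep_transversal := iter (size H * (size H).+1) serve [::].

End TransversalSearch.

Lemma uniq_unzip1_eq (A B : eqType) (s : seq (A * B)) a b b' :
  uniq (unzip1 s) -> (a, b) \in s -> (a, b') \in s -> b = b'.
Proof.
elim: s => //= -[a1 b1] s IH /= /andP[a1s us]; rewrite !inE.
case/predU1P=> [[aE bE]|ab] /predU1P[[aE' bE']|ab'].
- by rewrite bE bE'.
- by rewrite -aE (map_f fst ab') in a1s.
- by rewrite -aE' (map_f fst ab) in a1s.
- exact: IH.
Qed.

Section Transversal.
Context (U : choiceType) (S : {fset U}) (M : matroid S).
Context (near : rel U) (H Q : seq U).
Hypothesis Huniq : uniq H.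
Hypothesis near_inj : forall h h' x, h \in H -> h' \in H ->
  near h x -> near h' x -> h = h'.
Implicit Types (sg : seq (U * U)) (h x : U) (Z : seq U).

Let ind (s : seq U) := indep M [fset x in s].
Local Notation free := (free_heads H).
Local Notation candidates := (candidates near Q).
Local Notation augmenting := (augmenting ind near Q).
Local Notation releasable := (releasable ind near H Q).
Local Notation grow := (grow ind near H Q).
Local Notation search := (search ind near H Q).
Local Notation serve := (serve ind near H Q).

Definition valid_state sg :=
  [/\ uniq (unzip1 sg), forall e, e \in sg -> [/\ e.1 \in H, e.2 \in Q & near e.1 e.2]
    & ind (unzip2 sg)].

Definition feasible :=
  exists2 c : U -> U, (forall h, h \in H -> (c h \in Q) && near h (c h))
    & ind [seq c h | h <- H].

Let layer sg i := iter i (fun Z => releasable sg Z ++ Z) (free sg).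

Lemma fset_seq_cons x (s : seq U) : [fset y in x :: s] = x |` [fset y in s].
Proof. by apply/fsetP => y; rewrite !inE. Qed.

Lemma mem_candidates sg Z h x :
  ((h, x) \in candidates sg Z) =
  [&& h \in Z, x \in Q, x \notin unzip2 sg & near h x].
Proof.
rewrite mem_filter /= andbC; apply/andP/and4P => [[]|[hZ xQ xs nhx]].
  by case/allpairsP=> -[h' x'] [] /= hZ + [-> ->]; rewrite mem_filter => /andP[].
by split=> //; apply/allpairsP; exists (h, x); rewrite mem_filter /= xs.
Qed.

Lemma mem_augmenting sg Z h x :
  ((h, x) \in augmenting sg Z) =
  ind (x :: unzip2 sg) && ((h, x) \in candidates sg Z).
Proof. by rewrite mem_filter. Qed.

Lemma mem_releasable sg Z h :
  reflect [/\ h \in H, h \notin Z & exists g x, (g, x) \in candidates sg Z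
             /\ ind (x :: others sg h)]
          (h \in releasable sg Z).
Proof.
rewrite mem_filter; apply: (iffP andP) => [[/andP[hZ /hasP[[g x] gx ix] hH]]|].
  by split=> //; exists g, x.
move=> [hH hZ [g [x [gx ix]]]]; split=> //; rewrite hZ.
by apply/hasP; exists (g, x).
Qed.

Lemma others_fset sg h y :
  valid_state sg -> (h, y) \in sg ->
  [fset x in others sg h] = [fset x in unzip2 sg] `\ y.
Proof.
move=> [u1 val _] hy; apply/fsetP => x; rewrite !inE.
apply/mapP/andP => [[[g z]]|[xy /mapP[[g z] gz /= xz]]].
  rewrite mem_filter /= => /andP[gh gz] ->; split; last by apply: (map_f snd gz).
  apply: contra_neq gh => zy; have [gH _ ngz] := val _ gz.
  by have [hH _ nhy] := val _ hy; apply: (near_inj gH hH ngz); rewrite zy.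
exists (g, z); rewrite // mem_filter gz andbT /=.
apply: contraNneq xy => gh; rewrite xz.
by apply/eqP/(uniq_unzip1_eq u1 _ hy); rewrite -gh.
Qed.

Lemma mem_others sg h x :
  reflect (exists2 g, (g, x) \in sg & g != h) (x \in others sg h).
Proof.
apply: (iffP mapP) => [[[g z]]|[g gx gh]].
  by rewrite mem_filter /= => /andP[gh gz] ->; exists g.
by exists (g, x); rewrite // mem_filter gh.
Qed.

Lemma mem_free sg h : (h \in free sg) = (h \notin unzip1 sg) && (h \in H).
Proof. by rewrite mem_filter. Qed.

Lemma layerS sg i : layer sg i.+1 = releasable sg (layer sg i) ++ layer sg i.
Proof. by []. Qed.

Lemma layer_sub sg i j : (i <= j)%N -> {subset layer sg i <= layer sg j}.
Proof.
move=> /subnKC <-; elim: (j - i)%N => [|d IH]; rewrite ?addn0 // addnS layerS.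
by move=> h /IH hd; rewrite mem_cat hd orbT.
Qed.

Lemma layer_heads sg i : {subset layer sg i <= H}.
Proof.
elim: i => [|i IH] h; first by rewrite mem_free => /andP[].
by rewrite layerS mem_cat => /orP[/mem_releasable[]|/IH].
Qed.

Lemma layer_uniq sg i : uniq (layer sg i).
Proof.
elim: i => [|i IH]; first exact: filter_uniq.
rewrite layerS cat_uniq IH filter_uniq // andbT /= -all_predC.
by apply/allP => h hl; apply/negP => /mem_releasable[_]; rewrite hl.
Qed.

Let served sg h x := (h, x) :: [seq e <- sg | e.1 != h].

Lemma unzip2_served sg h x : unzip2 (served sg h x) = x :: others sg h.
Proof. by []. Qed.

Lemma served_valid sg h x :
  valid_state sg -> h \in H -> x \in Q -> near h x -> ind (x :: unzip2 sg) ->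
  valid_state (served sg h x).
Proof.
move=> [u1 val i2] hH xQ nhx ix; split.
- rewrite /= (subseq_uniq (map_subseq _ (filter_subseq _ _)) u1) andbT.
  by apply/mapP => -[e]; rewrite mem_filter => /andP[+ _] hE; rewrite hE eqxx.
- by move=> e; rewrite inE mem_filter => /predU1P[-> //|/andP[_ /val]].
- rewrite unzip2_served; apply: indep_subset ix; apply/fsubsetP => z.
  rewrite !inE => /predU1P[->|/mem_others[g gz _]]; rewrite ?eqxx //.
  by rewrite (map_f snd gz) orbT.
Qed.

Lemma size_served sg h x :
  valid_state sg -> size (served sg h x) = ((h \notin unzip1 sg) + size sg)%N.
Proof.
move=> [u1 _ _]; rewrite /= size_filter -(count_map fst (predC1 h)).
have := count_predC (pred1 h) (unzip1 sg); rewrite size_map.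
rewrite (count_uniq_mem h u1) => <-.
by case: (h \in _); rewrite /= ?add0n ?add1n.
Qed.

Lemma candidate_swap sg Z f x h x0 g y :
  valid_state sg -> augmenting sg Z = [::] -> (f, x) \in candidates sg Z ->
  x0 \notin unzip2 sg -> ind (x0 :: unzip2 sg) ->
  (g, y) \in sg -> ind (x :: others sg g) ->
  [/\ f \in Z, x \in Q, near f x, x \notin unzip2 (served sg h x0) &
      indep M (x |` (x0 |` [fset z in others sg g]))].
Proof.
move=> v a0 fx x0I ix0 gy ix.
have := fx; rewrite mem_candidates => /and4P[fZ xQ xI nfx].
have nix : ~~ ind (x :: unzip2 sg).
  by apply/negP => ix'; have := mem_augmenting sg Z f x; rewrite a0 fx ix'.
split=> //.
  rewrite unzip2_served inE negb_or; apply/andP; split.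
    by apply: contraNneq nix => ->.
  by apply: contraNN xI => /mem_others[z zx _]; apply: (map_f snd zx).
rewrite (others_fset v gy); apply: indep_swap.
- by rewrite !inE; apply: (map_f snd gy).
- by rewrite !inE.
- by move: ix0; rewrite /ind fset_seq_cons.
- by rewrite !inE.
- by move: nix; rewrite /ind fset_seq_cons.
- by move: ix; rewrite /ind fset_seq_cons (others_fset v gy).
Qed.

(* Serving [h] through a last-layer vertex shortens the alternating path: all
   earlier layers survive, and the vertex that put [h] in the last layer is
   now augmenting. *)
Lemma served_shorter sg d h x0 y :
  valid_state sg -> (forall i, (i <= d)%N -> augmenting sg (layer sg i) = [::]) ->
  (h, x0) \in augmenting sg (layer sg d.+1) -> (h, y) \in sg ->
  augmenting (served sg h x0) (layer (served sg h x0) d) != [::].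
Proof.
move=> v a0; rewrite mem_augmenting => /andP[ix0].
rewrite mem_candidates => /and4P[hl x0Q x0I nhx0] hy.
have hNd : h \notin layer sg d.
  apply/negP => hd; have := mem_augmenting sg (layer sg d) h x0.
  by rewrite a0 // ix0 mem_candidates hd x0Q x0I nhx0.
have sub i : (i <= d)%N -> {subset layer sg i <= layer (served sg h x0) i}.
  elim: i => [_ g|i IH ltid g].
    rewrite !mem_free /= inE => /andP[gI ->]; rewrite andbT negb_or.
    apply/andP; split.
      by apply: contraNneq gI => ->; apply: (map_f fst hy).
    apply: contraNN gI => /mapP[e]; rewrite mem_filter => /andP[_ es] ->.
    exact: map_f.
  move=> gl; have gd : g \in layer sg d by apply: layer_sub gl.
  rewrite layerS mem_cat in gl; rewrite layerS mem_cat.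
  case/orP: gl => [|/IH->]; rewrite ?orbT ?(ltnW ltid) //.
  case/mem_releasable => gH gNi [f [x [fx ix]]].
  have [gZ'|gN'] := boolP (g \in layer (served sg h x0) i); first by rewrite orbT.
  apply/orP; left; apply/mem_releasable; split=> //; exists f, x.
  have gI : g \in unzip1 sg.
    apply: contraNT gNi => gI; apply: (@layer_sub sg 0) => //.
    by rewrite mem_free gI.
  have /mapP[[g' z] gz /= gE] := gI; rewrite -gE in gz.
  have [fZ xQ nfx xI' iS] := candidate_swap h v (a0 _ (ltnW ltid)) fx x0I ix0 gz ix.
  split.
    by rewrite mem_candidates (IH (ltnW ltid)) // xQ xI' nfx.
  apply: indep_subset iS; apply/fsubsetP => w.
  rewrite !inE => /predU1P[->|/mem_others[k]]; first by rewrite eqxx.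
  rewrite inE mem_filter => /predU1P[[_ ->]|/andP[_ ks]] kg.
    by rewrite eqxx orbT.
  by apply/orP; right; apply/orP; right; apply/mem_others; exists k.
move: hl; rewrite layerS mem_cat (negbTE hNd) orbF => /mem_releasable[_ _].
move=> [f [x [fx ix]]].
have [fZ xQ nfx xI' iS] := candidate_swap h v (a0 _ (leqnn d)) fx x0I ix0 hy ix.
suff : (f, x) \in augmenting (served sg h x0) (layer (served sg h x0) d).
  by apply: contraTneq => ->.
rewrite mem_augmenting mem_candidates xQ xI' nfx (sub d) //= andbT.
by rewrite /ind !fset_seq_cons.
Qed.

(* Otherwise the elements near [Z] are spanned by the representatives of the
   heads of [Z], which are fewer than [Z]: Rado's condition fails. *)
Lemma feasible_unstuck sg Z :
  valid_state sg -> feasible -> {subset free sg <= Z} -> {subset Z <= H} ->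
  uniq Z -> free sg != [::] -> augmenting sg Z = [::] ->
  releasable sg Z != [::].
Proof.
move=> v [c cP ic] fZ ZH uZ f0 a0; apply/eqP => r0; have [u1 val i2] := v.
have cinj : {in H &, injective c}.
  move=> g g' gH g'H cE; have /andP[_ n1] := cP _ gH.
  by have /andP[_ n2] := cP _ g'H; apply: near_inj gH g'H n1 _; rewrite cE.
pose I := [fset x in unzip2 sg].
pose C := [fset x in [seq c h | h <- Z]].
pose J := [fset x in [seq e.2 | e <- sg & e.1 \in Z]].
have iC : indep M C.
  apply: indep_subset ic; apply/fsubsetP => z; rewrite !inE.
  by move=> /mapP[h /ZH hH ->]; apply: map_f.
have JI : J `<=` I.
  apply/fsubsetP => z; rewrite !inE => /mapP[e]; rewrite mem_filter.
  by move=> /andP[_ es] ->; apply: map_f.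
have iJ : indep M J by apply: indep_subset i2.
have ltJC : (#|` J| < #|` C|)%N.
  have -> : #|` C| = size Z.
    rewrite /C card_fseq undup_id ?size_map // map_inj_in_uniq //.
    by move=> ? ? /ZH ? /ZH ?; apply: cinj.
  rewrite card_fseq (leq_ltn_trans (size_undup _)) // size_map.
  rewrite size_filter -(count_map fst (mem Z)) -size_filter.
  have [h hf] : exists h, h \in free sg.
    by case: (free sg) f0 => // h l _; exists h; rewrite mem_head.
  have hZ := fZ _ hf; move: hf; rewrite mem_free => /andP[hN _].
  have : uniq (h :: [seq i <- unzip1 sg | i \in Z]).
    by rewrite /= filter_uniq // mem_filter (negbTE hN) andbF.
  move/uniq_leq_size; apply=> g; rewrite inE mem_filter.
  by move=> /predU1P[->|/andP[]].
have [z /fsetDP[+ zJ] iz] := indep_exchange iJ iC ltJC.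
rewrite !inE => /mapP[h hZ zE].
have hH := ZH _ hZ; have /andP[zQ nz] := cP _ hH; rewrite -zE in zQ nz.
have zI : z \notin unzip2 sg.
  apply: contraNN zJ => /mapP[[g x] gx /= zx]; rewrite /J !inE.
  apply/mapP; exists (g, x); rewrite // mem_filter gx andbT /=.
  have [gH _ ngx] := val _ gx; rewrite /= -zx in ngx.
  by have /= -> := near_inj gH hH ngx nz.
have hz : (h, z) \in candidates sg Z by rewrite mem_candidates hZ zQ zI nz.
have niz : ~~ indep M (z |` I).
  apply/negP => izI; have := mem_augmenting sg Z h z.
  by rewrite a0 hz /ind fset_seq_cons izI.
have ltJI : (#|` J| < #|` I|)%N.
  apply: fproper_ltn_card; rewrite fproperEneq JI andbT.
  by apply: contraNneq niz => <-.
have [|K [iK zJK KU cK]] := indep_extend iz (i2 : indep M I).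
  by rewrite cardfsU1 zJ.
have [y yI yK] : exists2 y, y \in I & y \notin K.
  apply/fsubsetPn; apply: contraNN niz => IK; apply: indep_subset iK.
  apply/fsubsetP => w /fset1UP[->|/(fsubsetP IK) //].
  by apply: (fsubsetP zJK); rewrite fset1U1.
have yJ : y \notin J.
  by apply: contraNN yK => yJ; apply: (fsubsetP zJK); rewrite fset1Ur.
move: yI; rewrite !inE => /mapP[[g y'] gy /= yE]; rewrite -{y'}yE in gy.
have [gH _ _] := val _ gy; rewrite /= in gH.
suff : g \in releasable sg Z by rewrite r0.
apply/mem_releasable; split=> //.
  apply: contraNN yJ => gZ; rewrite /J !inE; apply/mapP; exists (g, y) => //.
  by rewrite mem_filter gy gZ.
exists h, z; split=> //; rewrite /ind fset_seq_cons (others_fset v gy).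
suff -> : z |` [fset x in unzip2 sg] `\ y = K by [].
have zNy : z != y by apply: contraNneq yK => <-; apply: (fsubsetP zJK); rewrite fset1U1.
have KzI : K `<=` z |` (I `\ y).
  apply/fsubsetP => w wK; move/(fsubsetP KU): (wK); rewrite !inE.
  have wy : w != y by apply: contraNneq yK => <-.
  rewrite wy /= => /orP[/predU1P[->|wJ]|->]; rewrite ?eqxx ?orbT //.
  by move/fsubsetP: JI => /(_ w); rewrite !inE => ->; rewrite ?orbT.
apply/esym/eqP; rewrite eqEfcard KzI cK cardfsU1 in_fsetD1 zNy /= !inE zI.
have yI : y \in I by rewrite !inE (map_f snd gy).
by rewrite [leqRHS](cardfsD1 y I) yI.
Qed.

Lemma free_neq0 sg : valid_state sg ->
  (free sg != [::]) = (size sg < size H)%N.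
Proof.
move=> [u1 val _]; have sub : {subset unzip1 sg <= H}.
  by move=> h /mapP[e /val[? _ _] ->].
apply/idP/idP => [f0|lt].
  rewrite -(size_map fst) ltnNge; apply: contraNN f0 => le.
  have [_ sub'] := uniq_min_size u1 sub le.
  by rewrite -size_eq0 size_filter -leqn0 leqNgt -has_count; apply/hasPn => h; rewrite sub' => ->.
apply: contraTneq lt => f0; rewrite -leqNgt -(size_map fst) uniq_leq_size //.
move=> h hH; apply: contraT => hN.
by have := mem_free sg h; rewrite f0 hN hH.
Qed.

Lemma exists_augmenting_layer sg :
  valid_state sg -> feasible -> (size sg < size H)%N ->
  exists2 d, (d <= size H)%N & augmenting sg (layer sg d) != [::].
Proof.
move=> v feas lt; apply: contrapT => nex.
have a0 i : (i <= size H)%N -> augmenting sg (layer sg i) = [::].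
  by move=> le; apply/eqP; apply: contra_notT nex; exists i.
suff szl i : (i <= size H)%N -> (i < size (layer sg i))%N.
  have := szl _ (leqnn _); rewrite ltnNge uniq_leq_size //.
    exact: layer_uniq.
  exact: layer_heads.
elim: i => [_|i IH lei]; first by rewrite lt0n size_eq0 free_neq0.
rewrite layerS size_cat -add1n leq_add ?IH ?(ltnW lei) //.
rewrite lt0n size_eq0; apply: feasible_unstuck => //.
- exact: (@layer_sub sg 0).
- exact: layer_heads.
- exact: layer_uniq.
- by rewrite free_neq0.
- exact: a0 (ltnW lei).
Qed.

Lemma search_layer sg d :
  (d <= size H)%N -> (forall i, (i < d)%N -> augmenting sg (layer sg i) = [::]) ->
  augmenting sg (layer sg d) != [::] -> search sg = layer sg d.
Proof.
move=> led a0 ad; rewrite /search -(subnK led) iterD.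
have -> : iter d (grow sg) (free sg) = layer sg d.
  elim: {led ad} d a0 => //= d IH a0; rewrite IH => [|i lti].
    by rewrite /grow a0.
  exact/a0/ltnW.
elim: (size H - d)%N => //= m ->; rewrite /grow.
by case: nilP ad => // ->.
Qed.

Lemma search_heads sg : {subset search sg <= H}.
Proof.
rewrite /search; elim: (size H) => [h|m IH h /=].
  by rewrite mem_free => /andP[].
rewrite /grow; case: ifP => _; last exact: IH.
by rewrite mem_cat => /orP[/mem_releasable[]|/IH].
Qed.

Lemma serve_valid sg :
  valid_state sg -> valid_state (serve sg) /\ (size sg <= size (serve sg))%N.
Proof.
move=> v; rewrite /serve; case E: (augmenting _ _) => [|[h x] l] //.
have := mem_head (h, x) l; rewrite -E mem_augmenting => /andP[ix].
rewrite mem_candidates => /and4P[/search_heads hH xQ xI nhx].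
by rewrite size_served // leq_addl; split=> //; apply: served_valid.
Qed.

Lemma iter_serve_valid sg m :
  valid_state sg ->
  valid_state (iter m serve sg) /\ (size sg <= size (iter m serve sg))%N.
Proof.
move=> v; elim: m => //= m [vm le]; have [vm' le'] := serve_valid vm.
by split=> //; apply: leq_trans le'.
Qed.

Lemma iter_serve_lt sg d :
  valid_state sg -> (d <= size H)%N -> augmenting sg (layer sg d) != [::] ->
  (size sg < size (iter d.+1 serve sg))%N.
Proof.
elim/ltn_ind: d sg => d IH sg v led ad.
have [d0 ad0 min0] := ex_minnP (ex_intro (fun i => augmenting sg (layer sg i) != [::]) d ad).
have {min0} a0 i : (i < d0)%N -> augmenting sg (layer sg i) = [::].
  by move=> lti; apply/eqP; apply: contraTT lti => /min0; rewrite -leqNgt.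
have led0 : (d0 <= d)%N.
  by rewrite leqNgt; apply: contraNN ad => /a0 ->.
have sE : search sg = layer sg d0 by apply: search_layer; rewrite ?(leq_trans led0).
rewrite iterSr {2}/serve sE.
case E: (augmenting _ _) ad0 => [|[h x] l] // _.
have hxa : (h, x) \in augmenting sg (layer sg d0) by rewrite E mem_head.
have := hxa; rewrite mem_augmenting => /andP[ix].
rewrite mem_candidates => /and4P[hl xQ xI nhx].
have v' := served_valid v (layer_heads hl) xQ nhx ix.
have := size_served h x v; rewrite -/(served sg h x).
have [hI sz|hI sz] := boolP (h \in unzip1 sg); last first.
  by apply: leq_trans (proj2 (iter_serve_valid d v')); rewrite sz.
have /mapP[[h' y] hy /= hE] := hI; rewrite -hE in hy.
case: d0 led0 a0 hxa hl {sE E} => [_ _ _|d0 led0 a0 hxa _].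
  by rewrite mem_free hI.
have /(IH _ led0 _ v') : augmenting (served sg h x) (layer (served sg h x) d0) != [::].
  by apply: served_shorter hxa hy => // i; apply: a0.
rewrite sz add0n => /(_ (leq_trans (ltnW led0) led)) /leq_trans; apply.
rewrite -(subnK led0) iterD.
by case: (iter_serve_valid d0.+1 v') => v'' _; case: (iter_serve_valid (d - d0.+1) v'').
Qed.

Lemma transversal_valid : valid_state (indep_transversal ind near H Q).
Proof.
rewrite /indep_transversal.
have v0 : valid_state [::].
  by split=> //; rewrite /ind (_ : [fset x in _] = fset0) ?indep0 //; apply/fsetP => x; rewrite !inE.
by case: (iter_serve_valid (size H * (size H).+1) v0).
Qed.

Lemma transversal_complete :
  feasible -> free (indep_transversal ind near H Q) = [::].
Proof.
move=> feas; apply/eqP; rewrite -[_ == _]negbK free_neq0; last exact: transversal_valid.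
rewrite -leqNgt /indep_transversal; move: transversal_valid; rewrite /indep_transversal.
have v0 : valid_state [::].
  by split=> //; rewrite /ind (_ : [fset x in _] = fset0) ?indep0 //; apply/fsetP => x; rewrite !inE.
suff szm m : (m <= size H)%N -> (m <= size (iter (m * (size H).+1) serve [::]))%N.
  by move=> _; apply: szm.
elim: m => // m IH lem; rewrite mulSn iterD.
have [v le] := iter_serve_valid (m * (size H).+1) v0.
set sg := iter _ serve [::] in v le IH *.
have [leH|ltH] := leqP (size H) (size sg).
  by rewrite (leq_trans lem) // (leq_trans leH) //; case: (iter_serve_valid (size H).+1 v).
have [d led ad] := exists_augmenting_layer v feas ltH.
apply: leq_ltn_trans (IH (ltnW lem)) _.
apply: leq_trans (iter_serve_lt v led ad) _.
rewrite -(subnK led) -addnS iterD.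
by case: (iter_serve_valid d.+1 v) => v'' _; case: (iter_serve_valid (size H - d) v'').
Qed.

Lemma transversal_ind : ind (unzip2 (indep_transversal ind near H Q)).
Proof. by case: transversal_valid. Qed.

Lemma transversal_near h :
  free (indep_transversal ind near H Q) = [::] -> h \in H ->
  exists2 x, x \in unzip2 (indep_transversal ind near H Q) & near h x.
Proof.
move=> f0 hH; have [_ val _] := transversal_valid.
have : h \notin free (indep_transversal ind near H Q) by rewrite f0.
rewrite mem_free hH andbT negbK => /mapP[[g x] gx /= hE].
have [_ _ ngx] := val _ gx; exists x; last by rewrite hE.
exact: (map_f snd gx).
Qed.

End Transversal.

(** * Clustering a coreset *)

Section Clustering.
Context (R : realType) (U : metricType R).
Implicit Types (P Q : seq U) (r : R).

Section Algorithm.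
Context (ind : pred (seq U)).

Definition greedy_heads r P :=
  foldr (fun p Hs => if has (fun h => mdist h p <= r + r) Hs then Hs else p :: Hs)
    [::] P.

Definition solve r P Q :=
  indep_transversal ind (fun h x => mdist h x <= r) (greedy_heads r P) Q.

Definition try_radius P Q (e : U * U) (acc : option (R * seq U)) :=
  let r := mdist e.1 e.2 in
  if nilp (free_heads (greedy_heads r P) (solve r P Q)) then
    if acc is Some (r', _) then
      if r <= r' then Some (r, unzip2 (solve r P Q)) else acc
    else Some (r, unzip2 (solve r P Q))
  else acc.

Definition cluster P Q : seq U :=
  if foldr (try_radius P Q) None [seq (p, q) | p <- P, q <- Q] is Some (_, s)
  then s else [::].

End Algorithm.

Lemma greedy_heads_sub r P : {subset greedy_heads r P <= P}.
Proof.
elim: P => //= p P IH h; case: ifP => _; rewrite !inE.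
  by move/IH->; rewrite orbT.
by case/predU1P=> [->|/IH->]; rewrite ?eqxx ?orbT.
Qed.

Lemma greedy_heads_cover r P p :
  0 <= r -> p \in P -> exists2 h, h \in greedy_heads r P & mdist h p <= r + r.
Proof.
move=> r0; elim: P => //= p' P IH; rewrite inE.
case: ifPn => [/hasP[h hH hp]|_] /predU1P[->|/IH[h' h'H h'p]].
- by exists h.
- by exists h'.
- by exists p'; rewrite ?mem_head // mdistxx addr_ge0.
- by exists h'; rewrite // inE h'H orbT.
Qed.

Lemma greedy_heads_sep r P h h' :
  h \in greedy_heads r P -> h' \in greedy_heads r P -> mdist h h' <= r + r -> h = h'.
Proof.
elim: P => //= p P IH; case: ifPn => // /hasPn sep.
rewrite !inE => /predU1P[->|hP] /predU1P[->|h'P] //; last exact: IH.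
- by rewrite metric_sym => hh; have := sep _ h'P; rewrite hh.
- by move=> hh; have := sep _ hP; rewrite hh.
Qed.

Lemma greedy_heads_uniq r P : 0 <= r -> uniq (greedy_heads r P).
Proof.
move=> r0; elim: P => //= p P IH; case: ifPn => //= /hasPn sep; rewrite IH andbT.
by apply/negP => /sep; rewrite mdistxx addr_ge0.
Qed.

Lemma greedy_heads_inj r P h h' x :
  h \in greedy_heads r P -> h' \in greedy_heads r P ->
  mdist h x <= r -> mdist h' x <= r -> h = h'.
Proof.
move=> hH h'H hx h'x; apply: greedy_heads_sep hH h'H _.
by apply: le_trans (metric_triangle h x h') _; rewrite (metric_sym x) lerD.
Qed.

Section Correctness.
Context (S : {fset U}) (M : matroid S).

Let ind (s : seq U) := indep M [fset x in s].
Let covers r P (s : seq U) := forall p, p \in P -> exists2 x, x \in s & mdist p x <= r.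

Lemma solve_covers r P Q : 0 <= r ->
  nilp (free_heads (greedy_heads r P) (solve ind r P Q)) ->
  ind (unzip2 (solve ind r P Q)) /\ covers (3 * r) P (unzip2 (solve ind r P Q)).
Proof.
move=> r0 /nilP f0.
have ninj := @greedy_heads_inj r P; have Hu := greedy_heads_uniq P r0.
split; first exact: transversal_ind.
move=> p pP; have [h hH hp] := greedy_heads_cover r0 pP.
have [x xs hx] := transversal_near f0 hH.
exists x => //; have := metric_triangle p h x; rewrite (metric_sym p h).
by move: hp hx; lra.
Qed.

Lemma solve_complete r P Q C : 0 <= r -> ind C -> {subset C <= Q} ->
  covers r P C -> nilp (free_heads (greedy_heads r P) (solve ind r P Q)).
Proof.
move=> r0 iC CQ cov; apply/nilP.
have ninj := @greedy_heads_inj r P; have Hu := greedy_heads_uniq P r0.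
apply: (transversal_complete Hu ninj).
pose c p := nth p [seq x <- C | mdist p x <= r] 0%N.
have cP h : h \in greedy_heads r P -> (c h \in C) /\ (mdist h (c h) <= r).
  move=> /greedy_heads_sub/cov[x xC hx].
  have : c h \in [seq x <- C | mdist h x <= r].
    rewrite mem_nth // lt0n size_eq0; apply: contraTneq xC => e0.
    by apply/negP => xC; suff : x \in [::] by []; rewrite -e0 mem_filter hx.
  by rewrite mem_filter => /andP[].
exists c => [h /cP[/CQ -> //]|].
apply: indep_subset iC; apply/fsubsetP => z; rewrite !inE.
by move=> /mapP[h /cP[hC _] ->].
Qed.

Lemma cluster_correct rho P Q C :
  P != [::] -> ind C -> {subset C <= Q} -> covers rho P C ->
  ind (cluster ind P Q) /\ covers (3 * rho) P (cluster ind P Q).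
Proof.
move=> P0 iC CQ cov.
have [c cC] : exists c : U -> U,
    forall p, p \in P -> (c p \in C) /\ (mdist p (c p) <= rho).
  have /boolp.choice[c cP] : forall p, exists x,
      p \in P -> (x \in C) /\ (mdist p x <= rho).
    move=> p; have [/cov[x xC px]|pP] := boolP (p \in P); first by exists x.
    by exists p.
  by exists c.
have [p0 p0P p0max] : exists2 p, p \in P &
    forall p', p' \in P -> mdist p' (c p') <= mdist p (c p).
  elim: P P0 {cov cC} => // p P IH _; have [->|/IH[q qP qmax]] := eqVneq P [::].
    by exists p; rewrite ?mem_head // => q; rewrite inE => /eqP->.
  have [le|lt] := leP (mdist p (c p)) (mdist q (c q)).
    exists q; rewrite ?inE ?qP ?orbT // => x; rewrite inE.
    by move=> /predU1P[->//|/qmax].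
  exists p; rewrite ?mem_head // => x; rewrite inE => /predU1P[->//|/qmax].
  by move/le_trans; apply; apply: ltW.
have [c0C p0rho] := cC _ p0P.
have p0cov : covers (mdist p0 (c p0)) P C.
  by move=> p pP; exists (c p); [case: (cC p pP)|apply: p0max].
have suc := solve_complete (mdist_ge0 _ _) iC CQ p0cov.
suff inv l : let acc := foldr (try_radius ind P Q) None l in
    (forall r s, acc = Some (r, s) -> ind s /\ covers (3 * r) P s) /\
    ((p0, c p0) \in l -> exists r s, acc = Some (r, s) /\ r <= mdist p0 (c p0)).
  have [good /(_ _)[]] := inv [seq (p, q) | p <- P, q <- Q].
    by apply/allpairsP; exists (p0, c p0); split=> //=; apply: CQ.
  move=> r [s [accE rle]]; rewrite /cluster accE; have [is_ cov_s] := good _ _ accE.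
  split=> // p /cov_s[x xs px]; exists x => //; apply: le_trans px _.
  by rewrite ler_pM2l // (le_trans rle).
elim: l => [|e l /= [good best]]; first by split.
set acc := foldr _ _ l in good best *; rewrite /try_radius.
case: ifPn => [nf|nnf]; last first.
  by split=> //; rewrite inE => /predU1P[eE|/best//]; rewrite -eE suc in nnf.
have goodS := solve_covers (mdist_ge0 e.1 e.2) nf.
case accE : acc => [[r' s']|]; last first.
  split=> [r s [<- <-] //|]; rewrite inE => /predU1P[<-|].
    by eexists; eexists; split; first by [].
  by move/best => [r [s []]]; rewrite accE.
have [le|lt] := leP (mdist e.1 e.2) r'.
  split=> [r s [<- <-] //|]; rewrite inE => H; do 2 eexists; split; first by [].
  case/predU1P: H => [<- //|/best[r [s [+ rle]]]].
  by rewrite accE => -[rE _]; rewrite (le_trans le) // rE.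
split=> [r s E|]; first by apply: good; rewrite accE.
rewrite inE => /predU1P[eE|/best]; last by rewrite accE.
by exists r', s'; split=> //; rewrite ltW //; move: lt; rewrite -eE.
Qed.

Lemma indep_proxy (Q : seq U) (d : R) (X : {fset U}) :
  (forall x, x \in S -> exists Y A, [/\ max_indep M Y A, x \in Y,
     forall a, a \in A -> a \in Q & forall a, a \in A -> mdist x a <= d]) ->
  0 <= d -> indep M X ->
  exists2 C, ind C /\ {subset C <= Q} &
    forall x, x \in X -> exists2 y, y \in C & mdist x y <= d.
Proof.
move=> grp d0 iX.
suff [C [iC CQ _ Cd]] : exists C : {fset U}, [/\ indep M C,
    {subset C <= Q}, (forall x, x \in X -> x \in Q -> x \in C) &
    forall x, x \in X -> exists2 y, y \in C & mdist x y <= d].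
  exists C => //; split=> //; suff -> : ind C = indep M C by [].
  by congr (indep M _); apply/fsetP => z; rewrite !inE.
have [n] := ubnP #|` [fset x in X | x \notin Q]|; elim: n X iX => // n IH X iX.
have [[x /andP[xX xQ]]|nex] := pselect (exists x, (x \in X) && (x \notin Q)); last first.
  move=> _; exists X; split=> // [x xX|x xX].
    by apply: contra_notT nex => xQ; exists x; rewrite xX.
  by exists x; rewrite ?mdistxx.
have xS : x \in S by apply: fsubsetP (indep_sub iX) _ xX.
have [Y [A [mA xY AQ Ad]]] := grp _ xS.
have [y [yA yX iy]] := max_indep_proxy mA iX xX xY.
rewrite ltnS => ltn; have [|C [iC CQ Ckeep Cd]] := IH _ iy.
  apply: leq_trans ltn; apply: fproper_ltn_card; rewrite fproperE; apply/andP; split.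
    apply/fsubsetP => z; rewrite !inE => /andP[/orP[/eqP->|/andP[_ ->]] //].
    by rewrite AQ.
  apply/fsubsetPn; exists x; rewrite !inE ?xX // eqxx xQ /= !andbT orbF.
  by apply: contraNneq xQ => ->; apply: AQ.
exists C; split=> // z zX => [zQ|].
  by apply: Ckeep => //; rewrite !inE zX (contraNneq _ xQ) ?orbT // => <-.
have [->|zx] := eqVneq z x.
  by exists y; [apply: Ckeep; rewrite ?AQ // fset1U1|apply: Ad].
by apply: Cd; rewrite !inE zX zx orbT.
Qed.

End Correctness.
End Clustering.

(** * Cover trees *)

Section ListMembership.
Context (A B : Type).

Lemma In_map (f : A -> B) (s : seq A) y :
  List.In y (map f s) <-> exists2 x, List.In x s & y = f x.
Proof.
elim: s => /= [|a s IH]; first by split=> // -[].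
split=> [[<-|/IH[x xs yE]]|[x [->|xs] yE]]; [by exists a; [left|]| | by left|].
  by exists x => //; right.
by right; apply/IH; exists x.
Qed.

Lemma In_cat (s1 s2 : seq A) x :
  List.In x (s1 ++ s2) <-> List.In x s1 \/ List.In x s2.
Proof.
elim: s1 => /= [|a s IH]; first by split=> [|[]//]; right.
split=> [[->|/IH[]]|[[->|]|]]; auto; by right; apply/IH; auto.
Qed.

Lemma In_flatten (ss : seq (seq A)) x :
  List.In x (flatten ss) <-> exists2 s, List.In s ss & List.In x s.
Proof.
elim: ss => /= [|s ss IH]; first by split=> // -[].
split=> [/In_cat[xs|/IH[s' ? ?]]|[s' [<-|s'ss] xs']].
- by exists s; [left|].
- by exists s'; [right|].
- by apply/In_cat; left.
- by apply/In_cat; right; apply/IH; exists s'.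
Qed.

End ListMembership.

Lemma mem_In (A : eqType) (s : seq A) x : x \in s <-> List.In x s.
Proof.
elim: s => //= a s IH; rewrite inE; split=> [/predU1P[->|/IH]|[->|/IH->]]; auto.
  by rewrite eqxx.
by rewrite orbT.
Qed.

Section CoverTree.
Context (R : realType) (U : metricType R) (S : {fset U}) (T : cover_tree U).
Hypothesis Tct : is_cover_tree S T.
Local Notation etree := (etree U).
Implicit Types (u c : etree) (us : seq etree) (p q : U) (j l b : int).

Lemma level_le_root l p : p \in ct_points T l -> l <= ct_root_level T.
Proof.
have [_ [up _]] := Tct; rewrite leNgt; apply: contraTN => /up ->.
by rewrite in_fset0.
Qed.

Lemma ct_points_in l p : p \in ct_points T l -> p \in S.
Proof. by have [_ [_ [sub _]]] := Tct; apply/fsubsetP. Qed.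

Lemma ct_sep l p q :
  p \in ct_points T l -> q \in ct_points T l -> p != q -> 2 ^ l < mdist p q.
Proof. by have [_ [_ [_ [_ [_ [_ [_]]]]]]] := Tct; apply. Qed.

Lemma ct_points_le l l' p : l' <= l -> p \in ct_points T l -> p \in ct_points T l'.
Proof.
move=> le pl; have -> : l' = l - (`|l - l'|%N)%:Z by rewrite gez0_abs ?subr_ge0 //; lia.
elim: `|l - l'|%N => [|n IH]; first by rewrite subr0.
have [_ [_ [_ [_ [_ [nest _]]]]]] := Tct.
have := fsubsetP (nest (l - n%:Z)) _ IH.
by rewrite (_ : l - n%:Z - 1 = l - n.+1%:Z) //; lia.
Qed.

Lemma ct_childrenP l p q :
  reflect (q \in ct_points T (l - 1) /\ ct_parent T (l - 1) q = p)
    (q \in ct_children T l p).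
Proof. by rewrite !inE /=; apply: (iffP andP) => -[? /eqP]. Qed.

Lemma ct_child_dist l p q :
  l <= ct_root_level T -> q \in ct_children T l p ->
  [/\ p \in ct_points T l, q \in ct_points T (l - 1) & mdist p q <= 2 ^ l].
Proof.
have [_ [_ [_ [_ [par [_ [dist _]]]]]]] := Tct.
move=> lr /ct_childrenP[ql <-]; have lt : l - 1 < ct_root_level T by lia.
have := par _ _ lt ql; have := dist _ _ lt ql; rewrite metric_sym subrK.
by split.
Qed.

Lemma ct_self_child l p : p \in ct_points T l -> p \in ct_children T l p.
Proof.
move=> pl; have pl1 : p \in ct_points T (l - 1) by apply: ct_points_le pl; lia.
have pc : p \in ct_children T l (ct_parent T (l - 1) p) by apply/ct_childrenP.
have [ql _ d] := ct_child_dist (level_le_root pl) pc.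
apply/ct_childrenP; split=> //; apply: contraTeq d => ne.
by rewrite -ltNge; apply: ct_sep.
Qed.

Lemma explicit_from_node l p u :
  explicit_from T l p u -> epoint u = p /\ elevel u = l.
Proof. by case. Qed.

Definition at_level j u : Prop :=
  explicit_from T j (epoint u)
    (ENode (epoint u) j (eweight u) (emis u) (echildren u)).

Lemma explicit_at_level l u : explicit_from T l (epoint u) u -> at_level l u.
Proof.
move=> e; have [_ le] := explicit_from_node e.
by case: u e le => p l' w m cs /= + lE; rewrite lE.
Qed.

Definition expand j u :=
  if echildren u is c :: _ then
    if j <= elevel c + 1 then echildren u else [:: u]
  else [:: u].

Definition next_level j us := flatten [seq expand j u | u <- us].

Lemma at_level_inv j u : epoint u \in ct_points T j -> at_level j u ->
  (echildren u = [::] /\ forall i, i <= j -> ct_children T i (epoint u) = [fset epoint u])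
  \/ exists b c cs, [/\ echildren u = c :: cs, b <= j, elevel c = b - 1 &
     [/\ forall i, b < i -> i <= j -> ct_children T i (epoint u) = [fset epoint u],
      ct_children T b (epoint u) != [fset epoint u],
      perm_eq [seq epoint c | c <- echildren u] (ct_children T b (epoint u)) &
      forall c, List.In c (echildren u) -> explicit_from T (b - 1) (epoint c) c]].
Proof.
rewrite /at_level => pj e; inversion e as [? ? ? ? h|? b ? ? ? cs bj h ne pe hc]; subst.
  by left.
right; exists b; case E: (echildren u) => [|c cs].
  have := ct_self_child (ct_points_le bj pj).
  by have /perm_mem <- := pe; rewrite E.
exists c, cs; split=> //; last by rewrite -E.
by have [] := explicit_from_node (hc c _); rewrite ?E //=; left.
Qed.

Lemma expand_at j u :
  epoint u \in ct_points T j -> at_level j u ->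
  (forall c, List.In c (expand j u) -> at_level (j - 1) c) /\
  perm_eq [seq epoint c | c <- expand j u] (ct_children T j (epoint u)).
Proof.
move=> pj a; rewrite /expand.
have single : ct_children T j (epoint u) = [fset epoint u] ->
    perm_eq [:: epoint u] (ct_children T j (epoint u)).
  move=> ->; apply: uniq_perm; rewrite ?fset_uniq // => x.
  by rewrite inE /= in_fset1.
have [[cE h]|[b [c [cs [cE bj lc [h ne pe hc]]]]]] := at_level_inv pj a.
  rewrite cE; split=> [c [<-|//]|]; last by apply: single; apply: h.
  by rewrite /at_level cE; apply: explicit_leaf => i ?; apply: h; lia.
rewrite {1 3}cE lc subrK; case: ifPn => [jb|nb].
  have jE : j = b by lia.
  by rewrite jE; split=> // c' /hc/explicit_at_level.
split=> [c' [<-|//]|]; last by apply: single; apply: h; lia.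
by rewrite /at_level; apply: (explicit_branch (b := b)) => // [|i ? ?]; last apply: h; lia.
Qed.

(* [us] lists the nodes of level [j], each represented by the explicit node
   of its chain. *)
Definition frontier t j us : Prop :=
  [/\ j <= ct_root_level T, uniq [seq epoint u | u <- us],
      [seq epoint u | u <- us] =i ct_points T j &
      forall u, List.In u us -> at_level j u /\ node_of u t].

Lemma frontier_point t j us u :
  frontier t j us -> List.In u us -> epoint u \in ct_points T j.
Proof.
by move=> [_ _ <- _] uus; apply/mem_In/In_map; exists u.
Qed.

Lemma node_of_trans u c t : node_of u t -> List.In c (echildren u) -> node_of c t.
Proof.
elim=> [v cv|v d w dw _ IH cv]; first by apply: node_of_child cv _; constructor.
by apply: node_of_child dw _; apply: IH.
Qed.

Lemma expand_cases j u c : List.In c (expand j u) -> c = u \/ List.In c (echildren u).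
Proof.
rewrite /expand; case: (echildren u) => [[->|//]|d ds]; first by left.
by case: ifP => _; [right|case=> [->|//]; left].
Qed.

Lemma frontier_next t j us : frontier t j us -> frontier t (j - 1) (next_level j us).
Proof.
move=> fr; have pt u := @frontier_point t j us u fr; have [jr un me at_] := fr.
have mapE : [seq epoint u | u <- next_level j us] =
    flatten [seq [seq epoint c | c <- expand j u] | u <- us].
  by rewrite /next_level map_flatten -map_comp.
split; first by lia.
- rewrite mapE.
  have {me} : forall u, List.In u us -> uniq [seq epoint c | c <- expand j u] /\
      forall q, q \in [seq epoint c | c <- expand j u] -> ct_parent T (j - 1) q = epoint u.
    move=> u uus; have [_ pe] := expand_at (pt _ uus) (proj1 (at_ _ uus)).
    split; first by rewrite (perm_uniq pe) fset_uniq.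
    by move=> q; rewrite (perm_mem pe) => /ct_childrenP[].
  elim: us un {fr pt at_ mapE} => //= u us IH /andP[unu un] h.
  rewrite cat_uniq (proj1 (h u (or_introl erefl))) IH ?andbT //=; last by auto.
  apply/hasPn => q /flattenP[s /mem_In/In_map[v vus ->] qv]; apply: contraNN unu => qu.
  have <- : epoint v = epoint u.
    by rewrite -(proj2 (h v (or_intror vus)) _ qv) -(proj2 (h u (or_introl erefl)) _ qu).
  by apply/mem_In/In_map; exists v.
- move=> q; rewrite mapE; apply/flattenP/idP => [[s /mem_In/In_map[u uus ->]]|qj].
    have [_ pe] := expand_at (pt _ uus) (proj1 (at_ _ uus)).
    by rewrite (perm_mem pe) => /ct_childrenP[].
  have qc : q \in ct_children T j (ct_parent T (j - 1) q) by apply/ct_childrenP.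
  have [pj _ _] := ct_child_dist jr qc.
  move: pj; rewrite -me => /mem_In/In_map[u uus pE].
  have [_ pe] := expand_at (pt _ uus) (proj1 (at_ _ uus)).
  exists [seq epoint c | c <- expand j u]; last by rewrite (perm_mem pe) -pE.
  by apply/mem_In/In_map; exists u.
- move=> c /In_flatten[s /In_map[u uus ->] cu]; have [au nu] := at_ _ uus.
  split; first by apply: (proj1 (expand_at (pt _ uus) au)).
  by have [->//|cc] := expand_cases cu; apply: node_of_trans cc.
Qed.

Lemma subtree_pointsP u q :
  reflect (q = epoint u \/ exists2 c, List.In c (echildren u) & q \in subtree_points c)
    (q \in subtree_points u).
Proof.
case: u => p l w m cs /=.
have -> : (q \in foldr (fun c A => subtree_points c `|` A) [fset p] cs) =
   (q == p) || has (fun c => q \in subtree_points c) cs.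
  elim: cs => [|c cs IH] /=; first by rewrite inE orbF.
  by rewrite inE IH orbCA.
apply: (iffP orP) => [[/eqP->|]|[->|[c]]]; [by left| |by left|].
  move=> h; right; elim: cs h => //= c cs IH /orP[qc|/IH[d dcs qd]].
    by exists c; [left|].
  by exists d; [right|].
move=> h1 h2; right; elim: cs h1 => //= c' cs IH [->|/IH->]; rewrite ?h2 ?orbT //.
Qed.

Lemma subtree_points_self u : epoint u \in subtree_points u.
Proof. by apply/subtree_pointsP; left. Qed.

Lemma subtree_points_child u c q :
  List.In c (echildren u) -> q \in subtree_points c -> q \in subtree_points u.
Proof. by move=> cu qc; apply/subtree_pointsP; right; exists c. Qed.

Lemma ler_exp2 (l l' : int) : l <= l' -> 2 ^ l <= 2 ^ l' :> R.
Proof. by move=> le; rewrite ler_weXz2l // ler1n. Qed.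

Lemma exp2_gt0 (l : int) : 0 < 2 ^ l :> R.
Proof. by rewrite exprz_gt0 // ltr0n. Qed.

Lemma exp2S (l : int) : 2 ^ (l + 1) = 2 * 2 ^ l :> R.
Proof. by rewrite expfzDr ?pnatr_eq0 // expr1z mulrC. Qed.

Lemma explicit_subtree l p u : explicit_from T l p u -> p \in ct_points T l ->
  forall q, q \in subtree_points u -> q \in S /\ mdist p q <= 2 ^ (l + 1).
Proof.
elim=> {l p u} [l p w m _|l b p w m cs bl _ _ pe hc IH] pl q.
  case/subtree_pointsP => [->|[c []]] /=.
  by rewrite mdistxx; split; [apply: ct_points_in pl|apply/ltW/exp2_gt0].
case/subtree_pointsP => /= [->|[c ccs qc]].
  by rewrite mdistxx; split; [apply: ct_points_in pl|apply/ltW/exp2_gt0].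
have cb : epoint c \in ct_children T b p.
  by rewrite -(perm_mem pe); apply/mem_In/In_map; exists c.
have pb := ct_points_le bl pl.
have [_ cb1 d] := ct_child_dist (level_le_root pb) cb.
have [qS dq] := IH _ ccs cb1 _ qc; rewrite subrK in dq.
split=> //; apply: le_trans (metric_triangle p (epoint c) q) _.
apply: le_trans (ler_exp2 (l := b + 1) _); last by rewrite lerD2r.
by rewrite exp2S mulrDl mul1r lerD.
Qed.

Lemma frontier_subtree t j us u : frontier t j us -> List.In u us ->
  forall q, q \in subtree_points u -> q \in S /\ mdist (epoint u) q <= 2 ^ (j + 1).
Proof.
move=> fr uus q; have pu := frontier_point fr uus; have [_ _ _ /(_ _ uus)[au _]] := fr.
move=> qu; apply: (explicit_subtree au pu); move: qu; by case: u {uus pu au}.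
Qed.

Lemma next_level_subtree j us c q :
  List.In c (next_level j us) -> q \in subtree_points c ->
  exists2 u, List.In u us & q \in subtree_points u.
Proof.
case/In_flatten=> s /In_map[u uus ->] cu qc; exists u => //.
by have [<-//|cc] := expand_cases cu; apply: subtree_points_child qc.
Qed.

Lemma frontier_cover t j us q : frontier t j us -> q \in S ->
  exists2 u, List.In u us & q \in subtree_points u.
Proof.
have [_ [_ [_ [ex _]]]] := Tct => fr /ex[l ql].
have [jl|lj] := leP j l.
  have := ct_points_le jl ql; have [_ _ <- _] := fr => /mem_In/In_map[u uus ->].
  by exists u => //; apply: subtree_points_self.
have /= [n lE] : exists n : nat, l = j - n%:Z.
  by exists `|j - l|%N; lia.
have [us' fr' sub] : exists2 us', frontier t (j - n%:Z) us' &
    forall c x, List.In c us' -> x \in subtree_points c ->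
      exists2 u, List.In u us & x \in subtree_points u.
  elim: {lE} n => [|n [us' fr' sub]]; first by rewrite subr0; exists us => // c x; exists c.
  exists (next_level (j - n%:Z) us').
    by rewrite (_ : j - n.+1%:Z = j - n%:Z - 1); [apply: frontier_next|lia].
  by move=> c x cus /(next_level_subtree cus)[d dus]; apply: sub.
have [_ _ me _] := fr'; have := ql; rewrite lE -me => /mem_In/In_map[c cus ->].
by apply: sub cus _; apply: subtree_points_self.
Qed.

Lemma branch_dist b p : p \in ct_points T b -> ct_children T b p != [fset p] ->
  exists q, [/\ q \in S, p \in S, 2 ^ (b - 1) < mdist p q & (mdist p q <= 2 ^ b) && (p != q)].
Proof.
move=> pb ne; have pc := ct_self_child pb.
have [q qc qp] : exists2 q, q \in ct_children T b p & q \notin [fset p].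
  apply/fsubsetPn; apply: contraNN ne => sub; rewrite eqEfsubset sub.
  by rewrite fsub1set.
have [_ qb d] := ct_child_dist (level_le_root pb) qc.
have pq : p != q by rewrite eq_sym -in_fset1.
exists q; split; rewrite ?(ct_points_in pb) ?(ct_points_in qb) ?d //.
by apply: ct_sep => //; case/ct_childrenP: pc.
Qed.

Lemma nonleaf_dist t j us u : frontier t j us -> List.In u us -> echildren u <> [::] ->
  exists p q, [/\ p \in S, q \in S, p != q & mdist p q <= 2 ^ j].
Proof.
move=> fr uus ne; have pu := frontier_point fr uus; have [_ _ _ /(_ _ uus)[au _]] := fr.
have [[//]|[b [c [cs [cE bj lc [h nc pe hc]]]]]] := at_level_inv pu au.
have [q [qS pS _ /andP[d pq]]] := branch_dist (ct_points_le bj pu) nc.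
by exists (epoint u), q; split=> //; apply: le_trans d (ler_exp2 bj).
Qed.

Lemma leaf_subtree u : echildren u = [::] ->
  forall q, q \in subtree_points u -> q = epoint u.
Proof. by move=> uE q /subtree_pointsP[//|[c]]; rewrite uE. Qed.

Section Root.
Context (t : etree).
Hypothesis Tt : explicit_representation T t.

Lemma epoint_root : epoint t = ct_root T.
Proof. by have [] := explicit_from_node Tt. Qed.

Lemma elevel_root : elevel t = ct_root_level T.
Proof. by have [] := explicit_from_node Tt. Qed.

Lemma frontier_root : frontier t (elevel t) [:: t].
Proof.
rewrite elevel_root; have [rt _] := Tct; split=> //.
- by move=> q; rewrite rt /= epoint_root in_fset1 inE.
- move=> u [<-|//]; split; last by constructor.
  by apply: explicit_at_level; rewrite epoint_root.
Qed.

Lemma subtree_root : subtree_points t = S.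
Proof.
apply/fsetP => q; apply/idP/idP => [qt|/(frontier_cover frontier_root)].
  by apply: (proj1 (frontier_subtree frontier_root _ qt)); left.
by case=> u [<-|].
Qed.

Definition start_level := if echildren t is c :: _ then elevel c + 1 else elevel t.

Lemma frontier_start : frontier t start_level [:: t].
Proof.
rewrite /start_level; case E: (echildren t) => [|c0 cs0]; first exact: frontier_root.
have pr := frontier_point frontier_root (or_introl erefl : List.In t [:: t]).
have [_ _ _ /(_ t (or_introl erefl))[at_ _]] := frontier_root.
have [[]|[b [c [cs [cE bj lc [h ne pe hc]]]]]] := at_level_inv pr at_; first by rewrite E.
have [cc _] : c = c0 /\ cs = cs0 by move: cE; rewrite E => -[].
rewrite -cc lc subrK.
have -> : b = elevel t - `|elevel t - b|%N%:Z by lia.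
have : (`|elevel t - b|%N%:Z <= elevel t - b) by lia.
elim: `|elevel t - b|%N => [_|n IH le]; first by rewrite subr0; apply: frontier_root.
have /frontier_next := IH (ltac:(lia)).
rewrite /next_level /= cats0 /expand E -cc lc subrK ifN; last by lia.
by rewrite (_ : elevel t - n.+1%:Z = elevel t - n%:Z - 1) //; lia.
Qed.

Lemma start_dist : echildren t <> [::] ->
  exists p q, [/\ p \in S, q \in S & 2 ^ (start_level - 1) < mdist p q].
Proof.
have pr := frontier_point frontier_start (or_introl erefl : List.In t [:: t]).
have [_ _ _ /(_ t (or_introl erefl))[at_ _]] := frontier_start.
move: pr at_; rewrite /start_level; case E: (echildren t) => [|c0 cs0] // pr at_ _.
have [[]|[b [c [cs [cE bj lc [h ne pe hc]]]]]] := at_level_inv pr at_; first by rewrite E.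
have [cc _] : c = c0 /\ cs = cs0 by move: cE; rewrite E => -[].
have [q [qS pS d _]] := branch_dist (ct_points_le bj pr) ne.
by exists (epoint t), q; split=> //; rewrite -cc lc subrK.
Qed.

End Root.

End CoverTree.

Section Distances.
Context (R : realType) (U : metricType R) (S : {fset U}).
Implicit Types (p q c : U).

Lemma le_max_dist p q : p \in S -> q \in S -> mdist p q <= max_dist S.
Proof.
move=> pS qS; rewrite /max_dist.
apply: le_trans (le_bigmax_seq _ p _ _ pS isT).
exact: (le_bigmax_seq _ q _ _ qS isT).
Qed.

Lemma min_dist_le p q : p \in S -> q \in S -> p != q -> min_dist S <= mdist p q.
Proof.
move=> pS qS pq; rewrite /min_dist.
apply: le_trans (ge_bigmin_seq _ p _ _ pS isT) _.
by apply: (ge_bigmin_seq _ q) => //; rewrite eq_sym.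
Qed.

Lemma min_dist_gt0 p q : p \in S -> q \in S -> p != q -> 0 < min_dist S.
Proof.
move=> pS qS pq; have m0 : 0 < max_dist S.
  by apply: lt_le_trans (le_max_dist pS qS); rewrite mdist_gt0.
apply: lt_bigmin => // x _; apply: lt_bigmin => // y.
by rewrite mdist_gt0 eq_sym.
Qed.

Lemma bigmin_seq_attained (d : Order.disp_t) (A : orderType d) (I : eqType)
    (s : seq I) (x : A) (P : pred I) (F : I -> A) :
  \big[Order.min/x]_(i <- s | P i) F i = x \/
  exists2 i, i \in s & P i /\ \big[Order.min/x]_(i <- s | P i) F i = F i.
Proof.
elim: s => [|i s IH]; first by rewrite big_nil; left.
have tl : \big[Order.min/x]_(i <- s | P i) F i = x \/
  exists2 i0, i0 \in i :: s & P i0 /\ \big[Order.min/x]_(i <- s | P i) F i = F i0.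
  by case: IH => [->|[k ks kE]]; [left|right; exists k; rewrite // inE ks orbT].
rewrite big_cons; case: ifPn => // Pi; rewrite minEle.
by case: ifPn => // _; right; exists i; rewrite ?mem_head.
Qed.

Lemma cover_radius_le (C : {fset U}) (r : R) :
  (forall p, p \in S -> exists2 c, c \in C & mdist p c <= r) ->
  (cover_radius S C <= r%:E)%E.
Proof.
move=> cov; rewrite /cover_radius big_seq; apply: bigmax_le; first exact: leNye.
by move=> p /cov[c cC pc]; apply: (bigmin_inf_seq _ c xpredT).
Qed.

Lemma opt_radius_finite (M : matroid S) (A : {fset U}) p0 :
  p0 \in S -> indep M A -> A != fset0 ->
  exists rho C, [/\ opt_radius M = rho%:E, indep M C &
    forall p, p \in S -> exists2 c, c \in C & mdist p c <= rho].
Proof.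
move=> p0S iA /fset0Pn[a aA].
have inn p (C : {fset U}) : (-oo < \big[mine/+oo]_(q <- C) (mdist p q)%:E)%E.
  by apply: lt_bigmin => // q _; rewrite ltNyr.
have optA : (opt_radius M < +oo)%E.
  apply: le_lt_trans (_ : cover_radius S A < +oo)%E.
    by apply: (ge_bigmin_seq _ A (indep M)) => //; rewrite fpowersetE (indep_sub iA).
  apply: bigmax_lt => // p _; apply: le_lt_trans (ge_bigmin_seq _ a _ _ aA isT) _.
  by rewrite ltry.
have [optE|[C CS [iC optE]]] := bigmin_seq_attained (fpowerset S) +oo%E (indep M)
    (fun C => cover_radius S C).
  by move: optA; rewrite /opt_radius optE ltxx.
rewrite -/(opt_radius M) in optE.
have opt_ge p : p \in S ->
    (\big[mine/+oo]_(q <- C) (mdist p q)%:E <= opt_radius M)%E.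
  by move=> pS; rewrite optE; apply: (le_bigmax_seq _ p xpredT).
have fin : opt_radius M \is a fin_num.
  by rewrite fin_real // optA andbT (lt_le_trans (inn p0 C)) ?opt_ge.
exists (fine (opt_radius M)), C; split=> [|//|p pS]; first by rewrite fineK.
have := opt_ge _ pS.
have [->|[c cC [_ ->]]] := bigmin_seq_attained C +oo%E xpredT
    (fun q => (mdist p q)%:E).
  by rewrite leye_eq => /eqP optoo; rewrite optoo in optA.
by move=> le; exists c; rewrite // -lee_fin fineK.
Qed.

(* Two of the points of [X] share a center. *)
Lemma packing_radius (X : seq U) (C : {fset U}) (d r : R) :
  uniq X -> (#|` C| < size X)%N ->
  (forall p q, p \in X -> q \in X -> p != q -> d < mdist p q) ->
  (forall p, p \in X -> exists2 c, c \in C & mdist p c <= r) ->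
  d < 2 * r.
Proof.
move=> uX ltC sep cov.
have /boolp.choice[f fP] : forall p, exists c, p \in X -> (c \in C) /\ (mdist p c <= r).
  move=> p; have [/cov[c cC pc]|pX] := boolP (p \in X); first by exists c.
  by exists p.
have : ~~ uniq (map f X).
  apply: contraL ltC => u; rewrite -leqNgt -(size_map f) uniq_leq_size //.
  by move=> c /mapP[p /fP[pC _] ->].
move=> nu; have x0 : U by case: (X) ltC => //.
move: nu; case/(uniqPn x0) => i [j [ij]]; rewrite size_map => jX.
have iX := ltn_trans ij jX; rewrite !(nth_map x0) // => fE.
have pX := mem_nth x0 iX; have qX := mem_nth x0 jX.
have pq : nth x0 X i != nth x0 X j by rewrite nth_uniq // ltn_eqF.
have [_ d1] := fP _ pX; have [_ d2] := fP _ qX.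
have := sep _ _ pX qX pq; have := metric_triangle (nth x0 X i) (f (nth x0 X i)) (nth x0 X j).
by rewrite (metric_sym (f _)) {2}fE; move: d1 d2; lra.
Qed.

End Distances.

(** * Doubling dimension *)

Section Doubling.
Context (R : realType) (U : metricType R).
Implicit Types (p q : U) (X : seq U) (D r : R).

Lemma size_le_sum_filter (A B : eqType) (X : seq A) (cs : seq B) (near : B -> A -> bool) :
  (forall x, x \in X -> exists2 c, c \in cs & near c x) ->
  (size X <= \sum_(c <- cs) size [seq x <- X | near c x])%N.
Proof.
elim: X => // x X IH cov; have [c ccs cx] := cov _ (mem_head _ _).
have {}IH := IH (fun y yX => cov y (mem_behead (s := x :: X) yX)).
rewrite (eq_bigr (fun c => near c x + size [seq x <- X | near c x])%N); last first.
  by move=> c' _ /=; case: (near c' x).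
rewrite big_split /= -add1n leq_add // (big_rem c) //= cx.
by rewrite -addn1 addnC leq_add.
Qed.

Lemma doubling_packing D n p r X :
  doubling_bound U D -> uniq X -> (forall x, x \in X -> mdist p x <= r) ->
  (forall x y, x \in X -> y \in X -> x != y -> 2 * r < 2 ^+ n * mdist x y) ->
  (size X)%:R <= (2 `^ D) ^+ n :> R.
Proof.
move=> dbl; elim: n p r X => [|n IH] p r X uX ball sep.
  rewrite expr0 -[1]/(1%:R) ler_nat leqNgt; apply/negP => X2.
  case: X uX ball sep X2 => // x [//|y X] /= /andP[+ _] ball sep _.
  rewrite inE negb_or => /andP[xy _].
  have := sep x y; rewrite !inE !eqxx orbT mul1r => /(_ isT isT xy).
  have := ball x (mem_head _ _); have := ball y; rewrite !inE eqxx orbT => /(_ isT).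
  have := metric_triangle x p y; rewrite (metric_sym x p); lra.
have [cs [szcs cov]] := dbl p r.
have le := @size_le_sum_filter _ _ X cs (fun c x => mdist c x <= r / 2)
  (fun x xX => cov x (ball x xX)).
rewrite -(ler_nat R) in le; apply: le_trans le _; rewrite natr_sum exprS.
apply: (@le_trans _ _ (\sum_(c <- cs) (2 `^ D) ^+ n)).
  apply: ler_sum => c _; apply: (IH c (r / 2)); first exact: filter_uniq.
    by move=> x; rewrite mem_filter => /andP[].
  move=> x y; rewrite !mem_filter => /andP[_ xX] /andP[_ yX] xy.
  by have := sep x y xX yX xy; rewrite exprS; lra.
by rewrite big_const_seq iter_addr addr0 count_predT -[leLHS]mulr_natl ler_wpM2r.
Qed.

Lemma doubling_dimension_ge1 D p q : doubling_dimension U D -> p != q -> 1 <= D.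
Proof.
move=> [D0 dbl minD] pq; rewrite leNgt; apply/negP => D1.
have lt2 : 2 `^ D < 2 :> R.
  rewrite -ltr_ln ?posrE ?powR_gt0 // ln_powR gtr_pMl // ln_gt0 //.
  by rewrite (ltr_nat R 1 2).
have dbl0 : doubling_bound U 0.
  move=> x r; have [cs [szcs cov]] := dbl x r; exists cs; split=> //.
  rewrite powRr0 -[1]/(1%:R) ler_nat -ltnS -(ltr_nat R).
  exact: le_lt_trans szcs lt2.
have pqgt : 0 < mdist p q by rewrite mdist_gt0.
suff : (size [:: p; q])%:R <= (2 `^ 0) ^+ 2 :> R.
  by rewrite powRr0 expr1n -[1]/(1%:R) ler_nat.
apply: (doubling_packing (p := p) (r := mdist p q)) => //=.
- by rewrite inE pq.
- by move=> x; rewrite !inE => /orP[]/eqP->; rewrite // mdistxx ltW.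
- move=> x y; rewrite !inE => /orP[]/eqP-> /orP[]/eqP->; rewrite ?eqxx // => _.
    by rewrite expr2; lra.
  by rewrite (metric_sym q) expr2; lra.
Qed.

Section Growth.
Context (S : {fset U}) (T : cover_tree U).
Hypothesis Tct : is_cover_tree S T.

Lemma size_ct_children D l p : doubling_bound U D -> l <= ct_root_level T ->
  #|` ct_children T l p|%:R <= (2 `^ D) ^+ 2 :> R.
Proof.
move=> dbl lr; apply: (@doubling_packing D 2 p (2 ^ l)) => //.
- exact: fset_uniq.
- by move=> x /(ct_child_dist Tct lr)[].
- move=> x y /(ct_child_dist Tct lr)[_ xl _] /(ct_child_dist Tct lr)[_ yl _] xy.
  have := ct_sep Tct xl yl xy; have := exp2S R (l - 1); rewrite subrK.
  by move=> -> ?; rewrite expr2; lra.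
Qed.

Lemma size_next_level D t j us : doubling_bound U D -> frontier T t j us ->
  (size (next_level j us))%:R <= (2 `^ D) ^+ 2 * (size us)%:R :> R.
Proof.
move=> dbl fr; have [jr _ _ at_] := fr.
have pt u := frontier_point (u := u) fr.
have {pt}sz u : List.In u us -> (size (expand j u))%:R <= (2 `^ D) ^+ 2 :> R.
  move=> uus; have [_ pe] := expand_at Tct (pt _ uus) (proj1 (at_ _ uus)).
  by rewrite -(size_map (@epoint _)) (perm_size pe); apply: size_ct_children.
elim: us sz {fr at_} => [|u us IH] sz /=; first by rewrite mulr0.
rewrite /next_level /= size_cat natrD -(addn1 (size us)) natrD mulrDr mulr1 addrC.
apply: lerD; last by apply: sz; left.
by apply: IH => v vus; apply: sz; right.
Qed.

End Growth.
End Doubling.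

(** * Evaluation of programs *)

Definition tfst (e : term) := TCase e TNil (TVar 0).
Definition tsnd (e : term) := TCase e TNil (TVar 1).
Definition tnot (e : term) := TIf e (TBool false) (TBool true).
Definition tand (e e' : term) := TIf e e' (TBool false).

(* For points, distance at most 0 is equality. *)
Definition teq (e e' : term) :=
  TPrim2 PLeR (TPrim2 PDist e e') (TPrim1 PRealOfInt (TInt 0)).

Definition foldr_term : term :=
  TFun (TFun (TFun (TCase (TVar 0) (TVar 2)
    (TApp (TApp (TVar 6) (TVar 0)) (TApp (TVar 3) (TVar 1)))))).

Definition tfoldr (f z l : term) := TApp (TApp (TApp foldr_term f) z) l.

(* In a loop body, variable 0 is the accumulator, variable 2 the current
   element, and the variables of the context are shifted by 4. *)
Definition tloop (body z l : term) := tfoldr (TFun (TFun body)) z l.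
Definition tmap (body l : term) := tloop (TCons body (TVar 0)) TNil l.
Definition tfilter (body l : term) :=
  tloop (TIf body (TCons (TVar 2) (TVar 0)) (TVar 0)) TNil l.
Definition thas (body l : term) := tloop (TIf body (TBool true) (TVar 0)) (TBool false) l.
Definition tcat (l1 l2 : term) := tloop (TCons (TVar 2) (TVar 0)) l2 l1.
Definition tflatten (l : term) := tloop (tcat (TVar 2) (TVar 0)) TNil l.
Definition tlength (l : term) := tloop (TPrim2 PAddI (TVar 0) (TInt 1)) (TInt 0) l.

Section Evaluation.
Context (R : realType) (U : metricType R) (orc : pred {fset U}).
Local Notation value := (value R U).
Implicit Types (W : nat) (env : seq value) (v w f g : value) (e : term) (a : nat).

(* Costs are counted in units of [W] steps. *)
Definition ev W env e v a : Prop :=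
  exists2 n, evaluates orc env e v n & (n <= a * W)%N.

Definition app W f v w a : Prop :=
  if f is VClos env b then ev W (v :: f :: env) b w a else False.

Definition app2 W f v v' w a : Prop :=
  exists g a1 a2, [/\ app W f v g a1, app W g v' w a2 & (a1 + a2 <= a)%N].

Lemma ev_weak W W' env e v a : (W <= W')%N -> ev W env e v a -> ev W' env e v a.
Proof.
by move=> le [n en na]; exists n => //; apply: leq_trans na _; rewrite leq_mul2l le orbT.
Qed.

Lemma ev_le W env e v a a' : ev W env e v a -> (a <= a')%N -> ev W env e v a'.
Proof.
by move=> [n en na] le; exists n => //; apply: leq_trans na _; rewrite leq_mul2r le orbT.
Qed.

Lemma app2_le W f v v' w a a' : app2 W f v v' w a -> (a <= a')%N -> app2 W f v v' w a'.
Proof.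
by move=> [g [a1 [a2 [fg gw le]]]] le'; exists g, a1, a2; split=> //; apply: leq_trans le'.
Qed.

Section Rules.
Context (W : nat) (W0 : (0 < W)%N).

Lemma ev_var env i v : onth env i = Some v -> ev W env (TVar i) v 1.
Proof. by move=> h; exists 1; [constructor|rewrite mul1n]. Qed.

Lemma ev_int env z : ev W env (TInt z) (VInt z) 1.
Proof. by exists 1; [constructor|rewrite mul1n]. Qed.

Lemma ev_bool env b : ev W env (TBool b) (VBool b) 1.
Proof. by exists 1; [constructor|rewrite mul1n]. Qed.

Lemma ev_nil env : ev W env TNil VNil 1.
Proof. by exists 1; [constructor|rewrite mul1n]. Qed.

Lemma ev_fun env b : ev W env (TFun b) (VClos env b) 1.
Proof. by exists 1; [constructor|rewrite mul1n]. Qed.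

Lemma ev_cons env e1 e2 v1 v2 a1 a2 :
  ev W env e1 v1 a1 -> ev W env e2 v2 a2 ->
  ev W env (TCons e1 e2) (VCons v1 v2) (a1 + a2).+1.
Proof.
by move=> [n1 h1 l1] [n2 h2 l2]; exists (n1 + n2).+1; [constructor|nia].
Qed.

Lemma ev_case_nil env e e1 e2 v a a1 :
  ev W env e VNil a -> ev W env e1 v a1 -> ev W env (TCase e e1 e2) v (a + a1).+1.
Proof.
by move=> [n1 h1 l1] [n2 h2 l2]; exists (n1 + n2).+1; [apply: eval_case_nil h2|nia].
Qed.

Lemma ev_case_cons env e e1 e2 h t v a a2 :
  ev W env e (VCons h t) a -> ev W (h :: t :: env) e2 v a2 ->
  ev W env (TCase e e1 e2) v (a + a2).+1.
Proof.
by move=> [n1 h1 l1] [n2 h2 l2]; exists (n1 + n2).+1; [apply: eval_case_cons h2; exact: h1|nia].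
Qed.

Lemma ev_case_list (A : Type) (ea : A -> value) (l : seq A) env e e1 e2 v a a1 a2 :
  ev W env e (vlist [seq ea x | x <- l]) a ->
  (l = [::] -> ev W env e1 v a1) ->
  (forall x s, l = x :: s ->
     ev W (ea x :: vlist [seq ea x | x <- s] :: env) e2 v a2) ->
  ev W env (TCase e e1 e2) v (a + a1 + a2).+1.
Proof.
case: l => [|x s] he h1 h2.
  by apply: ev_le (ev_case_nil _ he (h1 erefl)) _; lia.
by apply: ev_le (ev_case_cons _ he (h2 x s erefl)) _; lia.
Qed.

Lemma ev_if env e e1 e2 (b : bool) v a a1 a2 :
  ev W env e (VBool b) a -> (b -> ev W env e1 v a1) -> (~~ b -> ev W env e2 v a2) ->
  ev W env (TIf e e1 e2) v (a + a1 + a2).+1.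
Proof.
move=> [n1 h1 l1] hT hF.
have [n h l] : ev W env (if b then e1 else e2) v (a1 + a2).
  by case: b h1 hT hF => _ hT hF; [apply: ev_le (hT isT) _|apply: ev_le (hF isT) _]; lia.
by exists (n1 + n).+1; [apply: eval_if h; exact: h1|nia].
Qed.

Lemma ev_let env e1 e2 v1 v a1 a2 :
  ev W env e1 v1 a1 -> ev W (v1 :: env) e2 v a2 -> ev W env (TLet e1 e2) v (a1 + a2).+1.
Proof.
by move=> [n1 h1 l1] [n2 h2 l2]; exists (n1 + n2).+1; [apply: eval_let h2; exact: h1|nia].
Qed.

Lemma ev_app env e1 e2 f v w a1 a2 a3 :
  ev W env e1 f a1 -> ev W env e2 v a2 -> app W f v w a3 ->
  ev W env (TApp e1 e2) w (a1 + a2 + a3).+1.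
Proof.
move=> [n1 h1 l1] [n2 h2 l2]; case: f h1 => // env' b h1 [n3 h3 l3].
by exists (n1 + n2 + n3).+1; [apply: eval_app h2 h3|nia].
Qed.

Lemma ev_app2 env e1 e2 e3 f v v' w a1 a2 a3 a4 :
  ev W env e1 f a1 -> ev W env e2 v a2 -> ev W env e3 v' a3 -> app2 W f v v' w a4 ->
  ev W env (TApp (TApp e1 e2) e3) w (a1 + a2 + a3 + a4).+2.
Proof.
move=> h1 h2 h3 [g [b1 [b2 [fg gw le]]]].
by apply: ev_le (ev_app (ev_app h1 h2 fg) h3 gw) _; lia.
Qed.

Lemma ev_prim1 env o e v w a :
  ev W env e v a -> prim1_sem orc o v = Some w -> ev W env (TPrim1 o e) w a.+1.
Proof. by move=> [n h l] ow; exists n.+1; [apply: eval_prim1 ow|nia]. Qed.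

Lemma ev_prim2 env o e1 e2 v1 v2 w a1 a2 :
  ev W env e1 v1 a1 -> ev W env e2 v2 a2 -> prim2_sem o v1 v2 = Some w ->
  ev W env (TPrim2 o e1 e2) w (a1 + a2).+1.
Proof.
by move=> [n1 h1 l1] [n2 h2 l2] ow; exists (n1 + n2).+1; [apply: eval_prim2 ow; eassumption|nia].
Qed.

Lemma app2_fun env b v v' w a :
  ev W (v' :: VClos (v :: VClos env (TFun b) :: env) b :: v :: VClos env (TFun b) :: env) b w a ->
  app2 W (VClos env (TFun b)) v v' w a.+1.
Proof.
move=> h; exists (VClos (v :: VClos env (TFun b) :: env) b), 1%N, a.
by split; [exact: ev_fun|exact: h|rewrite add1n].
Qed.

Lemma ev_fst env e v w a : ev W env e (VCons v w) a -> ev W env (tfst e) v a.+2.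
Proof.
by move=> h; apply: ev_le (ev_case_cons _ h (ev_var _)) _; rewrite ?addn1.
Qed.

Lemma ev_snd env e v w a : ev W env e (VCons v w) a -> ev W env (tsnd e) w a.+2.
Proof.
by move=> h; apply: ev_le (ev_case_cons _ h (ev_var _)) _; rewrite ?addn1.
Qed.

Lemma ev_not env e b a : ev W env e (VBool b) a -> ev W env (tnot e) (VBool (~~ b)) (a + 3).
Proof.
move=> h; apply: (ev_le (a := (a + 1 + 1).+1)); last by lia.
by apply: ev_if h _ _; case: b => // _; apply: ev_bool.
Qed.

Lemma ev_and env e e' (b b' : bool) a a' :
  ev W env e (VBool b) a -> (b -> ev W env e' (VBool b') a') ->
  ev W env (tand e e') (VBool (b && b')) (a + a' + 2).
Proof.
move=> h h'; apply: (ev_le (a := (a + a' + 1).+1)); last by lia.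
by apply: ev_if h _ _; case: b h' => // h' _; first [exact: h'|exact: ev_bool].
Qed.

Lemma ev_eq env e e' p q a a' :
  ev W env e (VPoint p) a -> ev W env e' (VPoint q) a' ->
  ev W env (teq e e') (VBool (p == q)) (a + a' + 4).
Proof.
move=> h h'; apply: ev_le.
  eapply ev_prim2; [eapply ev_prim2; [exact: h|exact: h'|reflexivity]
    |eapply ev_prim1; [exact: ev_int|reflexivity]|].
  by rewrite /= -[in RHS](negbK (p == q)) -mdist_gt0 -leNgt.
by lia.
Qed.

Lemma ev_foldr_sum (A B : Type) (ea : A -> value) (eb : B -> value) (F : A -> B -> B)
    (b0 : B) (l : seq A) (c : A -> nat) f env ef ez el a1 a2 a3 :
  ev W env ef f a1 -> ev W env ez (eb b0) a2 ->
  ev W env el (vlist [seq ea x | x <- l]) a3 ->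
  (forall s1 x s2, l = s1 ++ x :: s2 ->
     app2 W f (ea x) (eb (foldr F b0 s2)) (eb (F x (foldr F b0 s2))) (c x)) ->
  ev W env (tfoldr ef ez el) (eb (foldr F b0 l))
    (a1 + a2 + a3 + sumn [seq c x | x <- l] + 13 * size l + 12).
Proof.
move=> hf hz hl step.
pose env1 := f :: VClos env
  (TFun (TFun (TCase (TVar 0) (TVar 2)
    (TApp (TApp (TVar 6) (TVar 0)) (TApp (TVar 3) (TVar 1)))))) :: env.
pose env2 := eb b0 :: VClos env1 (TFun (TCase (TVar 0) (TVar 2)
    (TApp (TApp (TVar 6) (TVar 0)) (TApp (TVar 3) (TVar 1))))) :: env1.
pose self := VClos env2 (TCase (TVar 0) (TVar 2)
    (TApp (TApp (TVar 6) (TVar 0)) (TApp (TVar 3) (TVar 1)))).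
suff loop s s0 : l = s0 ++ s -> app W self (vlist [seq ea x | x <- s]) (eb (foldr F b0 s))
    (sumn [seq c x | x <- s] + 13 * size s + 4).
  apply: ev_le.
    eapply (@ev_app _ _ _ self); [|exact: hl|exact: (loop l [::])].
    eapply (@ev_app _ _ _ (VClos env1 _)); [|exact: hz|exact: ev_fun].
    by eapply ev_app; [apply: ev_fun|exact: hf|apply: ev_fun].
  by lia.
elim: s s0 => [|x s IH] s0 lE.
  apply: (ev_le (a := (1 + 1).+1)) => //.
  by apply: ev_case_nil; apply: ev_var.
apply: ev_le.
  eapply ev_case_cons; first by apply: ev_var.
  eapply ev_app2; [apply: ev_var; reflexivity|apply: ev_var; reflexivity| |exact: step lE].
  eapply ev_app; [by apply: ev_var|apply: ev_var; reflexivity|].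
  by apply: (IH (rcons s0 x)); rewrite cat_rcons.
by rewrite /=; lia.
Qed.

End Rules.

Section Loops.
Context (A B : Type) (ea : A -> value) (eb : B -> value).
Context (W W' : nat) (W0 : (0 < W)%N) (l : seq A) (lW : (size l * W <= W')%N) (W'0 : (0 < W')%N).

Lemma ev_loop (F : A -> B -> B) b0 env body ez el a2 a3 a4 :
  ev W' env ez (eb b0) a2 -> ev W' env el (vlist [seq ea x | x <- l]) a3 ->
  (forall s1 x s2 w1 w2, l = s1 ++ x :: s2 ->
     ev W (eb (foldr F b0 s2) :: w1 :: ea x :: w2 :: env) body
        (eb (F x (foldr F b0 s2))) a4) ->
  ev W' env (tloop body ez el) (eb (foldr F b0 l)) (a2 + a3 + a4 + 30).
Proof.
move=> [n2 h2 le2] [n3 h3 le3] step.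
have W1 : (0 < 1)%N by [].
have g2 : ev 1 env ez (eb b0) n2 by exists n2; rewrite ?muln1.
have g3 : ev 1 env el (vlist [seq ea x | x <- l]) n3 by exists n3; rewrite ?muln1.
have step1 s1 x s2 : l = s1 ++ x :: s2 ->
    app2 1 (VClos env (TFun body)) (ea x) (eb (foldr F b0 s2)) (eb (F x (foldr F b0 s2)))
      ((a4 * W).+1).
  move=> lE; apply: app2_fun => //.
  have [n h le] := step _ _ _ (VClos (ea x :: VClos env (TFun body) :: env) body)
    (VClos env (TFun body)) lE.
  by exists n => //; rewrite muln1.
have [n h le] := ev_foldr_sum W1 (ev_fun W1 env (TFun body)) g2 g3 step1.
exists n => //; apply: leq_trans le _; rewrite muln1.
have -> : sumn [seq (a4 * W).+1 | _ <- l] = (size l * (a4 * W).+1)%N.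
  by elim: (l) => //= ? s ->; rewrite mulSn.
have : (size l <= size l * W)%N by rewrite leq_pmulr.
by nia.
Qed.

End Loops.

Section ListLoops.
Context (A B : Type) (ea : A -> value) (eb : B -> value).
Context (W W' : nat) (W0 : (0 < W)%N) (l : seq A) (lW : (size l * W <= W')%N) (W'0 : (0 < W')%N).

Lemma cat_In (s1 : seq A) x s2 : l = s1 ++ x :: s2 -> List.In x l.
Proof. by move=> ->; apply/In_cat; right; left. Qed.

Lemma ev_map (g : A -> B) env body el a3 a4 :
  ev W' env el (vlist [seq ea x | x <- l]) a3 ->
  (forall x w1 w2 w3, List.In x l -> ev W (w1 :: w2 :: ea x :: w3 :: env) body (eb (g x)) a4) ->
  ev W' env (tmap body el) (vlist [seq eb y | y <- [seq g x | x <- l]]) (a3 + a4 + 33).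
Proof.
move=> hl h.
have -> : [seq g x | x <- l] = foldr (fun x s => g x :: s) [::] l.
  by elim: (l) => //= ? ? ->.
apply: ev_le.
  apply: (@ev_loop _ _ ea (fun s => vlist [seq eb y | y <- s]) W W') => //.
  - exact: ev_nil.
  - exact: hl.
  - move=> s1 x s2 w1 w2 lE; apply: ev_cons => //; last exact: ev_var.
    by apply: h; apply: cat_In lE.
by lia.
Qed.

Lemma ev_filter (p : pred A) env body el a3 a4 :
  ev W' env el (vlist [seq ea x | x <- l]) a3 ->
  (forall x w1 w2 w3, List.In x l -> ev W (w1 :: w2 :: ea x :: w3 :: env) body (VBool (p x)) a4) ->
  ev W' env (tfilter body el) (vlist [seq ea x | x <- [seq x <- l | p x]]) (a3 + a4 + 36).
Proof.
move=> hl h.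
have -> : [seq x <- l | p x] = foldr (fun x s => if p x then x :: s else s) [::] l.
  by elim: (l) => //= ? ? ->.
apply: ev_le.
  apply: (@ev_loop _ _ ea (fun s => vlist [seq ea y | y <- s]) W W') => //.
  - exact: ev_nil.
  - exact: hl.
  - move=> s1 x s2 w1 w2 lE; apply: ev_if => //; first by apply: h; apply: cat_In lE.
      by move=> ->; apply: ev_cons => //; apply: ev_var.
    by move=> /negbTE->; apply: ev_var.
by lia.
Qed.

Lemma ev_has (p : pred A) env body el a3 a4 :
  ev W' env el (vlist [seq ea x | x <- l]) a3 ->
  (forall x w1 w2 w3, List.In x l -> ev W (w1 :: w2 :: ea x :: w3 :: env) body (VBool (p x)) a4) ->
  ev W' env (thas body el) (VBool (has p l)) (a3 + a4 + 34).
Proof.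
move=> hl h.
have -> : has p l = foldr (fun x b => p x || b) false l.
  by elim: (l) => //= ? ? ->.
apply: ev_le.
  apply: (@ev_loop _ _ ea VBool W W') => //.
  - exact: ev_bool.
  - exact: hl.
  - move=> s1 x s2 w1 w2 lE; apply: ev_if => //; first by apply: h; apply: cat_In lE.
      by move=> ->; apply: ev_bool.
    by move=> /negbTE->; apply: ev_var.
by lia.
Qed.

End ListLoops.

Lemma ev_cat (A : Type) (ea : A -> value) W (l1 l2 : seq A) env e1 e2 a1 a2 :
  (0 < W)%N -> (size l1 <= W)%N ->
  ev W env e1 (vlist [seq ea x | x <- l1]) a1 ->
  ev W env e2 (vlist [seq ea x | x <- l2]) a2 ->
  ev W env (tcat e1 e2) (vlist [seq ea x | x <- l1 ++ l2]) (a1 + a2 + 33).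
Proof.
move=> W0 lW h1 h2; apply: ev_le.
  have -> : l1 ++ l2 = foldr cons l2 l1 by elim: (l1) => //= ? ? ->.
  apply: (@ev_loop _ _ ea (fun s => vlist [seq ea y | y <- s]) 1 W) => //.
  - by rewrite muln1.
  - exact: h2.
  - exact: h1.
  - by move=> s1 x s2 w1 w2 lE; apply: ev_cons => //; apply: ev_var.
by lia.
Qed.

Lemma ev_flatten (A : Type) (ea : A -> value) W W' (ll : seq (seq A)) env e a :
  (0 < W)%N -> (0 < W')%N -> (size ll * W <= W')%N ->
  (forall l, List.In l ll -> (size l <= W)%N) ->
  ev W' env e (vlist [seq vlist [seq ea x | x <- l] | l <- ll]) a ->
  ev W' env (tflatten e) (vlist [seq ea x | x <- flatten ll]) (a + 66).
Proof.
move=> W0 W'0 llW lW h; apply: ev_le.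
  apply: (@ev_loop _ _ (fun l => vlist [seq ea x | x <- l])
    (fun s => vlist [seq ea y | y <- s]) W W') => //.
  - exact: ev_nil.
  - exact: h.
  - move=> s1 x s2 w1 w2 lE; apply: ev_cat => //; try by apply: ev_var.
    by apply: lW; apply: cat_In lE.
by lia.
Qed.

Lemma ev_length (A : Type) (ea : A -> value) W (l : seq A) env e a :
  (0 < W)%N -> (size l <= W)%N ->
  ev W env e (vlist [seq ea x | x <- l]) a ->
  ev W env (tlength e) (VInt (size l)%:Z) (a + 34).
Proof.
move=> W0 lW h; apply: ev_le.
  have -> : VInt (size l)%:Z = VInt (foldr (fun _ n => n + 1) 0 l) :> value.
    by congr VInt; elim: (l) => //= _ s <-; rewrite -addn1 PoszD.
  apply: (@ev_loop _ _ ea VInt 1 W) => //.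
  - by rewrite muln1.
  - exact: ev_int.
  - exact: h.
  - move=> s1 x s2 w1 w2 lE.
    by apply: ev_prim2 => //; [apply: ev_var|apply: ev_int|].
by lia.
Qed.

End Evaluation.

(** * Program for the clustering *)

Definition treps (sg : nat) := tmap (tsnd (TVar 2)) (TVar sg).
Definition theads (sg : nat) := tmap (tfst (TVar 2)) (TVar sg).

Definition tfree (Hs sg : nat) :=
  tfilter (tnot (thas (teq (TVar 2) (TVar 6)) (theads sg.+4))) (TVar Hs).

Definition tothers (sg h : nat) :=
  tmap (tsnd (TVar 2))
    (tfilter (tnot (teq (tfst (TVar 2)) (TVar h.+4))) (TVar sg)).

Definition tallpairs (l1 l2 : nat) :=
  tflatten (tmap (tmap (TCons (TVar 6) (TVar 2)) (TVar l2.+4)) (TVar l1)).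

Definition tcandidates (sg Z Q r : nat) :=
  TLet (tfilter (tnot (thas (teq (TVar 2) (TVar 6)) (treps sg.+4))) (TVar Q))
    (tfilter (TPrim2 PLeR (TPrim2 PDist (tfst (TVar 2)) (tsnd (TVar 2))) (TVar r.+1.+4))
       (tallpairs Z.+1 0)).

Definition taugmenting (sg Z Q r : nat) :=
  tfilter (TPrim1 PIndep (TCons (tsnd (TVar 2)) (treps sg.+4)))
    (tcandidates sg Z Q r).

Definition treleasable (sg Z Hs Q r : nat) :=
  TLet (tcandidates sg Z Q r)
    (tfilter (tand (tnot (thas (teq (TVar 2) (TVar 6)) (TVar Z.+1.+4)))
        (thas (TPrim1 PIndep (TCons (tsnd (TVar 2)) (tothers sg.+1.+4.+4 6)))
           (TVar 4)))
       (TVar Hs.+1)).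

Definition tgrow (sg Z Hs Q r : nat) :=
  TCase (taugmenting sg Z Q r) (tcat (treleasable sg Z Hs Q r) (TVar Z)) (TVar Z.+2).

Definition tsearch (sg Hs Q r : nat) :=
  tloop (tgrow sg.+4 0 Hs.+4 Q.+4 r.+4) (tfree Hs sg) (TVar Hs).

Definition tserve (sg Hs Q r : nat) :=
  TLet (tsearch sg Hs Q r)
    (TCase (taugmenting sg.+1 0 Q.+1 r.+1) (TVar sg.+1)
       (TCons (TVar 0)
          (tfilter (tnot (teq (tfst (TVar 2)) (tfst (TVar 4)))) (TVar sg.+3)))).

Definition ttransversal (Hs Q r : nat) :=
  tloop (tloop (tserve 0 Hs.+4.+4 Q.+4.+4 r.+4.+4) (TVar 0) (TCons TNil (TVar Hs.+4)))
    TNil (TVar Hs).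

Definition tgreedy_heads (r P : nat) :=
  tloop (TIf (thas (TPrim2 PLeR (TPrim2 PDist (TVar 2) (TVar 6))
                      (TPrim2 PAddR (TVar r.+4.+4) (TVar r.+4.+4))) (TVar 0))
           (TVar 0) (TCons (TVar 2) (TVar 0)))
    TNil (TVar P).

Definition ttry_radius (P Q : nat) :=
  TLet (TPrim2 PDist (tfst (TVar 2)) (tsnd (TVar 2)))
  (TLet (tgreedy_heads 0 P.+4.+1)
  (TLet (ttransversal 0 Q.+4.+2 1)
  (TCase (tfree 1 0)
     (TCase (TVar 3) (TCons (TVar 2) (treps 0))
        (TIf (TPrim2 PLeR (TVar 4) (TVar 0)) (TCons (TVar 4) (treps 2)) (TVar 5)))
     (TVar 5)))).

Definition tcluster (P Q : nat) :=
  TCase (tloop (ttry_radius P Q) TNil (tallpairs P Q)) TNil (TVar 1).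

Section ClusterEval.
Context (R : realType) (U : metricType R) (S : {fset U}) (M : matroid S).
Context (N : nat) (N0 : (0 < N)%N).
Local Notation value := (value R U).
Local Notation ev := (ev (indep M)).
Local Notation vpts s := (vlist [seq VPoint x | x <- s] : value).
Let vpair (e : U * U) : value := VCons (VPoint e.1) (VPoint e.2).
Local Notation vpairs s := (vlist [seq vpair e | e <- s]).
Let ind (s : seq U) := indep M [fset x in s].
Implicit Types (env : seq value) (sg : seq (U * U)) (Z Q P H : seq U).

Lemma posN i : (0 < N ^ i)%N.
Proof. by rewrite expn_gt0 N0. Qed.

Lemma ev_weakN i j env e v a : (i <= j)%N -> ev (N ^ i) env e v a -> ev (N ^ j) env e v a.
Proof. by move=> ij; apply: ev_weak; rewrite leq_pexp2l. Qed.

Local Notation varN := (ev_var _ (posN _)).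
Local Notation nilN := (ev_nil _ (posN _)).
Local Notation consN := (ev_cons (posN _)).
Local Notation case_listN := (ev_case_list (posN _)).
Local Notation ifN := (ev_if (posN _)).
Local Notation letN := (ev_let (posN _)).
Local Notation prim2N := (ev_prim2 (posN _)).
Local Notation fstN := (ev_fst (posN _)).
Local Notation sndN := (ev_snd (posN _)).
Local Notation notN := (ev_not (posN _)).
Local Notation andN := (ev_and (posN _)).
Local Notation eqN := (ev_eq (posN _)).

Section Wrappers.
Context (A B : Type) (ea : A -> value) (eb : B -> value) (i j : nat) (l : seq A).
Hypothesis sl : (size l <= N ^ i)%N.

Let lW : (size l * N ^ j <= N ^ (i + j))%N.
Proof. by rewrite expnD leq_mul2r sl orbT. Qed.

Lemma loopN (F : A -> B -> B) b0 env body ez el a2 a3 a4 :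
  ev (N ^ (i + j)) env ez (eb b0) a2 ->
  ev (N ^ (i + j)) env el (vlist [seq ea x | x <- l]) a3 ->
  (forall s1 x s2 w1 w2, l = s1 ++ x :: s2 ->
     ev (N ^ j) (eb (foldr F b0 s2) :: w1 :: ea x :: w2 :: env) body
        (eb (F x (foldr F b0 s2))) a4) ->
  ev (N ^ (i + j)) env (tloop body ez el) (eb (foldr F b0 l)) (a2 + a3 + a4 + 30).
Proof. exact: (ev_loop (posN j) lW (posN _)). Qed.

Lemma mapN (g : A -> B) env body el a3 a4 :
  ev (N ^ (i + j)) env el (vlist [seq ea x | x <- l]) a3 ->
  (forall x w1 w2 w3, List.In x l ->
     ev (N ^ j) (w1 :: w2 :: ea x :: w3 :: env) body (eb (g x)) a4) ->
  ev (N ^ (i + j)) env (tmap body el) (vlist [seq eb y | y <- [seq g x | x <- l]])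
    (a3 + a4 + 33).
Proof. exact: (ev_map (posN j) lW (posN _)). Qed.

Lemma filterN (p : pred A) env body el a3 a4 :
  ev (N ^ (i + j)) env el (vlist [seq ea x | x <- l]) a3 ->
  (forall x w1 w2 w3, List.In x l ->
     ev (N ^ j) (w1 :: w2 :: ea x :: w3 :: env) body (VBool (p x)) a4) ->
  ev (N ^ (i + j)) env (tfilter body el) (vlist [seq ea x | x <- [seq x <- l | p x]])
    (a3 + a4 + 36).
Proof. exact: (ev_filter (posN j) lW (posN _)). Qed.

Lemma hasN (p : pred A) env body el a3 a4 :
  ev (N ^ (i + j)) env el (vlist [seq ea x | x <- l]) a3 ->
  (forall x w1 w2 w3, List.In x l ->
     ev (N ^ j) (w1 :: w2 :: ea x :: w3 :: env) body (VBool (p x)) a4) ->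
  ev (N ^ (i + j)) env (thas body el) (VBool (has p l)) (a3 + a4 + 34).
Proof. exact: (ev_has (posN j) lW (posN _)). Qed.

End Wrappers.

Lemma has_eq_mem (x : U) (s : seq U) : has (fun y => y == x) s = (x \in s).
Proof.
by elim: s => //= y s ->; rewrite inE eq_sym.
Qed.

Lemma ev_unzip2 sg env i : onth env i = Some (vpairs sg) -> (size sg <= N)%N ->
  ev (N ^ 1) env (treps i) (vpts (unzip2 sg)) 40.
Proof.
move=> hi sz; apply: ev_le.
  apply: (@mapN _ _ vpair (@VPoint R U) 1 0 sg)=> //.
    by apply: varN; exact: hi.
  by move=> [h x] w1 w2 w3 _ /=; apply: sndN; apply: varN.
by [].
Qed.

Lemma ev_unzip1 sg env i : onth env i = Some (vpairs sg) -> (size sg <= N)%N ->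
  ev (N ^ 1) env (theads i) (vpts (unzip1 sg)) 40.
Proof.
move=> hi sz; apply: ev_le.
  apply: (@mapN _ _ vpair (@VPoint R U) 1 0 sg)=> //.
    by apply: varN; exact: hi.
  by move=> [h x] w1 w2 w3 _ /=; apply: fstN; apply: varN.
by [].
Qed.

Lemma ev_mem env e z (s : seq U) x a a' :
  (forall w1 w2 w3 w4, ev (N ^ 0) (w1 :: w2 :: w3 :: w4 :: env) z (VPoint x) a) ->
  (size s <= N)%N -> ev (N ^ 1) env e (vpts s) a' ->
  ev (N ^ 1) env (thas (teq (TVar 2) z) e) (VBool (x \in s)) (a + a' + 50).
Proof.
move=> hz sz hs; apply: ev_le.
  rewrite -has_eq_mem.
  apply: (@hasN _ (@VPoint R U) 1 0 s)=> //; first exact: hs.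
  by move=> y w1 w2 w3 _; apply: eqN; [apply: varN|apply: hz].
by lia.
Qed.

Lemma ev_free H sg env iH isg :
  onth env iH = Some (vpts H) -> onth env isg = Some (vpairs sg) ->
  (size H <= N)%N -> (size sg <= N)%N ->
  ev (N ^ 2) env (tfree iH isg) (vpts (free_heads H sg)) 200.
Proof.
move=> hH hsg szH szsg; apply: ev_le.
  apply: (@filterN _ (@VPoint R U) 1 1 H)=> //; first exact: varN hH.
  move=> h w1 w2 w3 _; apply: notN.
  apply: ev_mem; last 1 first.
  - by apply: ev_unzip1; [exact: hsg|].
  - by move=> *; apply: varN.
  - by rewrite size_map.
by [].
Qed.

Lemma ev_others sg h env isg ih :
  onth env isg = Some (vpairs sg) -> onth env ih = Some (VPoint h) ->
  (size sg <= N)%N -> ev (N ^ 1) env (tothers isg ih) (vpts (others sg h)) 100.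
Proof.
move=> hsg hh sz; apply: ev_le.
  apply: (@mapN _ _ vpair (@VPoint R U) 1 0).
  - by rewrite (leq_trans _ sz) // size_filter count_size.
  - apply: (@filterN _ vpair 1 0 sg)=> //; first exact: varN hsg.
    move=> [g x] w1 w2 w3 _ /=; apply: notN; apply: eqN.
      by apply: fstN; apply: varN.
    apply: varN; exact: hh.
  - by move=> [g x] w1 w2 w3 _ /=; apply: sndN; apply: varN.
by [].
Qed.

Lemma ev_allpairs (P Q : seq U) env iP iQ :
  onth env iP = Some (vpts P) -> onth env iQ = Some (vpts Q) ->
  (size P <= N)%N -> (size Q <= N)%N ->
  ev (N ^ 2) env (tallpairs iP iQ) (vpairs [seq (p, q) | p <- P, q <- Q]) 200.
Proof.
move=> hP hQ szP szQ; apply: ev_le.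
  apply: (@ev_flatten _ _ _ _ vpair (N ^ 1) (N ^ 2)); rewrite ?posN //.
  - by rewrite size_map -mulnn leq_mul.
  - by move=> l /In_map[p _ ->]; rewrite size_map.
  - apply: (@mapN _ _ (@VPoint R U) (fun l => vpairs l) 1 1 P _
      (fun p => [seq (p, q) | q <- Q]))=> //; first exact: varN hP.
    move=> p w1 w2 w3 _.
    apply: (@mapN _ _ (@VPoint R U) vpair 1 0 Q)=> //.
      by apply: varN; exact: hQ.
    by move=> q w4 w5 w6 _; apply: consN; apply: varN.
by [].
Qed.

Lemma points_of_vpoints (s : seq U) : points_of_value (vpts s) = Some s.
Proof. by elim: s => //= x s ->. Qed.

Lemma ev_indep W env e (s : seq U) a : (0 < W)%N ->
  ev W env e (vpts s) a -> ev W env (TPrim1 PIndep e) (VBool (ind s)) a.+1.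
Proof. by move=> W0 h; apply: ev_prim1 => //=; [exact: h|rewrite points_of_vpoints]. Qed.

Local Notation indN := (ev_indep (posN _)).
Local Notation near r := (fun h x : U => mdist h x <= r).

Section Instance.
Context (r : R) (H Q : seq U).
Hypotheses (szH : (size H < N)%N) (szQ : (size Q <= N)%N).

Lemma ev_le_dist i env e1 e2 e3 p q a1 a2 a3 (r' : R) :
  ev (N ^ i) env e1 (VPoint p) a1 -> ev (N ^ i) env e2 (VPoint q) a2 ->
  ev (N ^ i) env e3 (VReal r') a3 ->
  ev (N ^ i) env (TPrim2 PLeR (TPrim2 PDist e1 e2) e3) (VBool (mdist p q <= r'))
    ((a1 + a2).+1 + a3).+1.
Proof.
move=> h1 h2 h3; eapply prim2N; [|exact: h3|].
  by eapply prim2N; [exact: h1|exact: h2|reflexivity].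
by [].
Qed.

Lemma size_candidates sg Z : (size Z <= N)%N -> (size (candidates (near r) Q sg Z) <= N ^ 2)%N.
Proof.
move=> szZ; rewrite size_filter (leq_trans (count_size _ _)) //.
rewrite size_allpairs -mulnn leq_mul // (leq_trans _ szQ) //.
by rewrite size_filter count_size.
Qed.

Lemma ev_candidates sg Z env isg iZ iQ ir :
  onth env isg = Some (vpairs sg) -> onth env iZ = Some (vpts Z) ->
  onth env iQ = Some (vpts Q) -> onth env ir = Some (VReal r) ->
  (size sg <= N)%N -> (size Z <= N)%N ->
  ev (N ^ 2) env (tcandidates isg iZ iQ ir) (vpairs (candidates (near r) Q sg Z)) 600.
Proof.
move=> hsg hZ hQ hr szsg szZ.
have szA : (size [seq x <- Q | x \notin unzip2 sg] <= N)%N.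
  by rewrite size_filter (leq_trans (count_size _ _)).
apply: ev_le.
  apply: letN.
    apply: (@filterN _ (@VPoint R U) 1 1 Q)=> //; first exact: varN hQ.
    move=> x w1 w2 w3 _; apply: notN.
    apply: (ev_mem (s := unzip2 sg)); rewrite ?size_map //.
      by move=> *; apply: varN.
    by apply: ev_unzip2.
  apply: (@filterN _ vpair 2 0); last 1 first.
  - move=> [h x] w1 w2 w3 _; apply: ev_le_dist.
    + by apply: fstN; apply: varN.
    + by apply: sndN; apply: varN.
    + by apply: varN; exact: hr.
  - by rewrite size_allpairs -mulnn leq_mul.
  - by apply: ev_allpairs.
by [].
Qed.

Lemma ev_augmenting sg Z env isg iZ iQ ir :
  onth env isg = Some (vpairs sg) -> onth env iZ = Some (vpts Z) ->
  onth env iQ = Some (vpts Q) -> onth env ir = Some (VReal r) ->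
  (size sg <= N)%N -> (size Z <= N)%N ->
  ev (N ^ 3) env (taugmenting isg iZ iQ ir) (vpairs (augmenting ind (near r) Q sg Z)) 800.
Proof.
move=> hsg hZ hQ hr szsg szZ; apply: ev_le.
  apply: (@filterN _ vpair 2 1); first exact: size_candidates.
    by apply: (ev_weakN (i := 2)) => //; apply: ev_candidates.
  move=> [h x] w1 w2 w3 _; apply: indN; apply: consN.
    by apply: sndN; apply: varN.
  by apply: ev_unzip2.
by [].
Qed.

Lemma ev_releasable sg Z env isg iZ iH iQ ir :
  onth env isg = Some (vpairs sg) -> onth env iZ = Some (vpts Z) ->
  onth env iH = Some (vpts H) ->
  onth env iQ = Some (vpts Q) -> onth env ir = Some (VReal r) ->
  (size sg <= N)%N -> (size Z <= N)%N ->
  ev (N ^ 4) env (treleasable isg iZ iH iQ ir)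
    (vpts (releasable ind (near r) H Q sg Z)) 1200.
Proof.
move=> hsg hZ hH hQ hr szsg szZ; apply: ev_le.
  apply: letN.
    by apply: (ev_weakN (i := 2)) => //; apply: ev_candidates; eassumption.
  apply: (@filterN _ (@VPoint R U) 1 3 H)=> //; first exact: ltnW.
    by apply: varN; exact: hH.
  move=> h w1 w2 w3 _; apply: andN.
    apply: notN; apply: (ev_weakN (i := 1)) => //; apply: ev_mem.
    - by move=> *; apply: varN.
    - exact: szZ.
    - by apply: varN; exact: hZ.
  move=> _; apply: (@hasN _ vpair 2 1); first exact: size_candidates.
    by apply: varN.
  move=> [g x] w4 w5 w6 _; apply: indN; apply: consN.
    by apply: sndN; apply: varN.
  by apply: ev_others.
by [].
Qed.

Lemma size_releasable sg Z : (size (releasable ind (near r) H Q sg Z) <= N)%N.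
Proof. by rewrite size_filter (leq_trans (count_size _ _)) // ltnW. Qed.

Lemma ev_grow sg Z env isg iZ iH iQ ir :
  onth env isg = Some (vpairs sg) -> onth env iZ = Some (vpts Z) ->
  onth env iH = Some (vpts H) ->
  onth env iQ = Some (vpts Q) -> onth env ir = Some (VReal r) ->
  (size sg <= N)%N -> (size Z <= N)%N ->
  ev (N ^ 4) env (tgrow isg iZ iH iQ ir) (vpts (grow ind (near r) H Q sg Z)) 2100.
Proof.
move=> hsg hZ hH hQ hr szsg szZ; apply: ev_le.
  apply: (case_listN (ea := vpair)).
  - by apply: (ev_weakN (i := 3)) => //; apply: ev_augmenting; eassumption.
  - move=> aE; rewrite /grow aE /=; apply: ev_cat; rewrite ?posN //.
    + by apply: leq_trans (size_releasable _ _) _; rewrite -[leqLHS]expn1 leq_pexp2l.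
    + by apply: ev_releasable; eassumption.
    + exact: varN hZ.
  - move=> e l aE; rewrite /grow aE /=.
    by apply: varN; exact: hZ.
by [].
Qed.

Hypothesis uH : uniq H.

Let grow_sub sg Z : uniq Z -> {subset Z <= H} ->
  uniq (grow ind (near r) H Q sg Z) /\ {subset grow ind (near r) H Q sg Z <= H}.
Proof.
move=> uZ ZH; rewrite /grow; case: ifP => // _; split.
  rewrite cat_uniq uZ filter_uniq // andbT /= -all_predC.
  by apply/allP => h hZ; rewrite /= mem_filter hZ.
by move=> h; rewrite mem_cat mem_filter => /orP[/andP[]|/ZH].
Qed.

Lemma size_iter_grow sg i :
  (size (iter i (grow ind (near r) H Q sg) (free_heads H sg)) <= size H)%N.
Proof.
suff [uZ ZH] : uniq (iter i (grow ind (near r) H Q sg) (free_heads H sg)) /\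
    {subset iter i (grow ind (near r) H Q sg) (free_heads H sg) <= H}.
  exact: uniq_leq_size.
elim: i => [|i [uZ ZH]]; last exact: grow_sub.
by rewrite filter_uniq //; split=> // h; rewrite mem_filter => /andP[].
Qed.

Lemma foldr_iter (A B : Type) (f : B -> B) (b : B) (l : seq A) :
  foldr (fun _ => f) b l = iter (size l) f b.
Proof. by elim: l => //= _ l ->. Qed.

Lemma iter_mul (B : Type) (f : B -> B) (b : B) m n :
  iter (m * n) f b = iter m (iter n f) b.
Proof. by elim: m => // m IH; rewrite mulSn iterD IH. Qed.

Lemma ev_search sg env isg iH iQ ir :
  onth env isg = Some (vpairs sg) -> onth env iH = Some (vpts H) ->
  onth env iQ = Some (vpts Q) -> onth env ir = Some (VReal r) -> (size sg <= N)%N ->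
  ev (N ^ 5) env (tsearch isg iH iQ ir) (vpts (search ind (near r) H Q sg)) 2400.
Proof.
move=> hsg hH hQ hr szsg; rewrite /search -(foldr_iter _ _ H); apply: ev_le.
  apply: (@loopN _ _ (@VPoint R U) (fun Z => vpts Z) 1 4 H) => //; first exact: ltnW.
  - by apply: (ev_weakN (i := 2)) => //; apply: ev_free => //; apply: ltnW.
  - exact: varN hH.
  - move=> s1 x s2 w1 w2 _; rewrite foldr_iter; apply: ev_grow => //.
    exact: leq_trans (size_iter_grow _ _) (ltnW szH).
by [].
Qed.

Lemma ev_serve sg env isg iH iQ ir :
  onth env isg = Some (vpairs sg) -> onth env iH = Some (vpts H) ->
  onth env iQ = Some (vpts Q) -> onth env ir = Some (VReal r) -> (size sg <= N)%N ->
  ev (N ^ 5) env (tserve isg iH iQ ir) (vpairs (serve ind (near r) H Q sg)) 3400.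
Proof.
move=> hsg hH hQ hr szsg; apply: ev_le.
  apply: letN; first by apply: ev_search; eassumption.
  apply: (case_listN (ea := vpair)
    (l := augmenting ind (near r) Q sg (search ind (near r) H Q sg))).
  - apply: (ev_weakN (i := 3)) => //; apply: ev_augmenting => //.
    by rewrite /search (leq_trans (size_iter_grow _ _)) // ltnW.
  - by move=> aE; rewrite /serve aE; apply: varN; exact: hsg.
  - move=> [h x] l aE; rewrite /serve aE; apply: consN; first by apply: varN.
    apply: (ev_weakN (i := 1)) => //.
    apply: (@filterN _ vpair 1 0 sg _ (fun e => e.1 != h)) => //.
      by apply: varN; exact: hsg.
    by move=> e w1 w2 w3 _; apply: notN; apply: eqN; apply: fstN; apply: varN.
by [].
Qed.

Lemma size_valid_state sg : valid_state M (near r) H Q sg -> (size sg <= size H)%N.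
Proof.
move=> [u1 val _]; rewrite -(size_map fst) uniq_leq_size //.
by move=> h /mapP[e /val[? _ _] ->].
Qed.

Lemma ev_transversal env iH iQ ir :
  onth env iH = Some (vpts H) -> onth env iQ = Some (vpts Q) ->
  onth env ir = Some (VReal r) ->
  ev (N ^ 7) env (ttransversal iH iQ ir)
    (vpairs (indep_transversal ind (near r) H Q)) 3600.
Proof.
move=> hH hQ hr; have v0 : valid_state M (near r) H Q [::].
  split=> //; rewrite (_ : [fset x in _] = fset0) ?indep0 //.
  by apply/fsetP => x; rewrite !inE.
have sz m : (size (iter m (serve ind (near r) H Q) [::]) <= N)%N.
  have [v _] := iter_serve_valid m v0.
  exact: leq_trans (size_valid_state v) (ltnW szH).
have -> : indep_transversal ind (near r) H Q =
    foldr (fun _ => iter (size H).+1 (serve ind (near r) H Q)) [::] H.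
  by rewrite foldr_iter -iter_mul.
apply: ev_le.
  apply: (@loopN _ _ (@VPoint R U) (fun sg => vpairs sg) 1 6 H) => //; first exact: ltnW.
  - exact: nilN.
  - exact: varN hH.
  - move=> s1 x s2 w1 w2 _.
    have -> : foldr (fun _ => iter (size H).+1 (serve ind (near r) H Q)) [::] s2 =
        iter (size s2 * (size H).+1) (serve ind (near r) H Q) [::].
      by rewrite foldr_iter -iter_mul.
    set m := (size s2 * _)%N.
    have -> : (size H).+1 = size (VNil :: [seq VPoint x | x <- H] : seq value).
      by rewrite /= size_map.
    rewrite -foldr_iter.
    apply: (@loopN _ _ id (fun sg => vpairs sg) 1 5) => //=.
    + by rewrite size_map.
    + exact: varN.
    + by rewrite map_id; apply: consN; [apply: nilN|apply: varN; exact: hH].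
    + move=> s1' y s2' w3 w4 _; rewrite foldr_iter -iterD.
      by apply: ev_serve; rewrite ?sz.
by [].
Qed.

End Instance.

Let vopt (o : option (R * seq U)) : value :=
  if o is Some (r, s) then VCons (VReal r) (vpts s) else VNil.

Lemma size_greedy_heads r P : (size (greedy_heads r P) <= size P)%N.
Proof. by elim: P => //= p P; case: ifP => //= _ /leqW. Qed.

Lemma ev_greedy_heads r P env ir iP :
  onth env ir = Some (VReal r) -> onth env iP = Some (vpts P) -> (size P <= N)%N ->
  ev (N ^ 2) env (tgreedy_heads ir iP) (vpts (greedy_heads r P)) 200.
Proof.
move=> hr hP szP; rewrite /greedy_heads; apply: ev_le.
  apply: (@loopN _ _ (@VPoint R U) (fun Z => vpts Z) 1 1 P) => //.
  - exact: nilN.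
  - exact: varN hP.
  - move=> s1 p s2 w1 w2 PE; rewrite -/(greedy_heads r s2).
    have szs : (size (greedy_heads r s2) <= N)%N.
      rewrite (leq_trans (size_greedy_heads _ _)) // (leq_trans _ szP) // PE.
      by rewrite size_cat /=; lia.
    apply: (ifN (b := has (fun h => mdist h p <= r + r) (greedy_heads r s2))).
    + apply: (@hasN _ (@VPoint R U) 1 0) => //; first by apply: varN.
      move=> h w3 w4 w5 _; apply: ev_le_dist; try by apply: varN.
      by eapply prim2N; [apply: varN; exact: hr|apply: varN; exact: hr|].
    + by move=> ->; apply: varN.
    + by move=> /negbTE->; apply: consN; apply: varN.
by [].
Qed.

Section Search.
Context (P Q : seq U).
Hypotheses (szP : (size P < N)%N) (szQ : (size Q <= N)%N).

Lemma ev_try_radius e acc env iP iQ w1 w2 :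
  onth env iP = Some (vpts P) -> onth env iQ = Some (vpts Q) ->
  ev (N ^ 7) (vopt acc :: w1 :: vpair e :: w2 :: env) (ttry_radius iP iQ)
    (vopt (try_radius ind P Q e acc)) 4500.
Proof.
move=> hP hQ; rewrite /try_radius; set r := mdist e.1 e.2.
set Hs := greedy_heads r P; have uH : uniq Hs by apply: greedy_heads_uniq (mdist_ge0 _ _).
have szH : (size Hs < N)%N by apply: leq_ltn_trans (size_greedy_heads _ _) szP.
set sg := solve ind r P Q.
have szsg : (size sg <= N)%N.
  by apply: leq_trans (size_valid_state (transversal_valid _ _ _ _)) (ltnW szH).
apply: ev_le.
  apply: (letN (v1 := VReal r)).
    eapply prim2N; [|apply: sndN; by apply: varN|].
      by apply: fstN; apply: varN.
    by [].
  apply: letN.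
    apply: (ev_weakN (i := 2)) => //; apply: (ev_greedy_heads (r := r) (P := P)) => //.
    exact: ltnW.
  apply: (letN (v1 := vpairs sg)); first by apply: (ev_transversal (r := r) szH szQ uH).
  apply: (case_listN (ea := @VPoint R U) (l := free_heads Hs sg)).
  - apply: (ev_weakN (i := 2)) => //; apply: ev_free => //; exact: ltnW.
  - move=> fE; rewrite fE /=.
    case: acc => [[r' s']|].
      apply: (@ev_le _ _ _ _ _ _ _ 200) => //.
      apply: ev_le; first eapply ev_case_cons; rewrite ?posN //; first by apply: varN.
        apply: (ifN (b := r <= r')).
        + by eapply prim2N; [by apply: varN|by apply: varN|].
        + move=> ->; apply: consN; first by apply: varN.
          by apply: (ev_weakN (i := 1)) => //; apply: ev_unzip2.
        + by move=> /negbTE->; apply: varN.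
      by [].
    apply: ev_le; first eapply ev_case_nil; rewrite ?posN //; first by apply: varN.
      apply: consN; first by apply: varN.
      by apply: (ev_weakN (i := 1)) => //; apply: ev_unzip2.
    by [].
  - by move=> x s fE; rewrite fE /=; apply: varN.
by [].
Qed.

Lemma ev_cluster env iP iQ :
  onth env iP = Some (vpts P) -> onth env iQ = Some (vpts Q) ->
  ev (N ^ 9) env (tcluster iP iQ) (vpts (cluster ind P Q)) 4800.
Proof.
move=> hP hQ; rewrite /cluster; set o := foldr _ _ _.
have h : ev (N ^ 9) env (tloop (ttry_radius iP iQ) TNil (tallpairs iP iQ)) (vopt o) 4750.
  apply: ev_le.
    apply: (@loopN _ _ vpair vopt 2 7).
    - by rewrite size_allpairs -mulnn leq_mul // ltnW.
    - exact: nilN.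
    - apply: (ev_weakN (i := 2)) => //; apply: ev_allpairs => //; exact: ltnW.
    - by move=> s1 e s2 w1 w2 _; apply: ev_try_radius.
  by [].
case: o h => [[r s]|] h.
  apply: ev_le; first eapply ev_case_cons; rewrite ?posN //; [exact: h|by apply: varN|].
  by [].
apply: ev_le; first eapply ev_case_nil; rewrite ?posN //; [exact: h|exact: nilN|].
by [].
Qed.

End Search.
End ClusterEval.

(** * Program for the descent of the tree *)

Definition take_body : term :=
  TIf (TPrim2 PLeI (TVar 2) (TInt 0)) TNil
    (TCase (TVar 0) TNil
       (TCons (TVar 0)
          (TApp (TApp (TVar 5) (TPrim2 PSubI (TVar 4) (TInt 1))) (TVar 1)))).
Definition take_term : term := TFun (TFun take_body).

Definition tnonleaf (us : nat) : term :=
  thas (TCase (TPrim1 PChildren (TVar 2)) (TBool false) (TBool true)) (TVar us).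

Definition tstep (trunc : term) (us j : nat) : term :=
  tloop
    (TCase (TPrim1 PChildren (TVar 2)) (TCons (TVar 2) (TVar 0))
       (TIf (TPrim2 PLeI (TVar j.+4.+2) (TPrim2 PAddI (TPrim1 PLevel (TVar 0)) (TInt 1)))
          (tcat trunc (TVar 2)) (TCons (TVar 4) (TVar 2))))
    TNil (TVar us).

(* Variable [K] holds the rank plus one: truncating the lists of children to
   this length keeps a step linear in the size of its result, and still
   reveals whether the next level has more nodes than the rank. *)
Definition phase1_body (K : nat) : term :=
  TIf (tnonleaf 2)
    (TLet (tstep (TApp (TApp take_term (TVar K.+4.+4.+2)) (TPrim1 PChildren (TVar 4))) 2 0)
       (TIf (TPrim2 PLeI (TVar K.+4.+1) (tlength (TVar 0)))
          (TCons (TVar 3) (TVar 1))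
          (TApp (TApp (TVar 4) (TVar 0)) (TPrim2 PSubI (TVar 1) (TInt 1)))))
    (TCons (TVar 2) (TVar 0)).

Definition phase2_body : term :=
  TLet (tfst (TVar 2)) (TLet (tsnd (TVar 3))
    (TIf (tnonleaf 1)
       (TIf (TPrim2 PLeR (TPrim1 PRealOfInt (TInt 1)) (TVar 2)) (TVar 1)
          (TApp (TApp (TVar 5)
             (TCons (tstep (TPrim1 PChildren (TVar 4)) 1 0) (TPrim2 PSubI (TVar 0) (TInt 1))))
             (TPrim2 PAddR (TVar 2) (TVar 2))))
       (TVar 1))).

Definition program : term :=
  TCase (TPrim1 PMis (TVar 0)) TNil
  (TLet (TPrim2 PAddI (tlength (TPrim1 PMis (TVar 2))) (TInt 1))
  (TLet (TCase (TPrim1 PChildren (TVar 3)) (TPrim1 PLevel (TVar 3))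
           (TPrim2 PAddI (TPrim1 PLevel (TVar 0)) (TInt 1)))
  (TLet (TApp (TApp (TFun (TFun (phase1_body 1))) (TCons (TVar 4) TNil)) (TVar 0))
  (TLet (TApp (TApp (TFun (TFun phase2_body)) (TVar 0)) (TVar 6))
  (TLet (tmap (TPrim1 PPoint (TVar 2)) (TVar 0))
  (TLet (tflatten (tmap (TPrim1 PMis (TVar 2)) (TVar 1)))
     (tcluster 1 0))))))).

Section Descent.
Context (R : realType) (U : metricType R) (orc : pred {fset U}).
Local Notation value := (value R U).
Local Notation ev := (ev orc).
Local Notation app2 := (app2 orc).
Local Notation vtrees s := (vlist [seq VTree u | u <- s] : value).
Implicit Types (env : seq value) (us : seq (etree U)) (j : int).

Lemma ev_unit W env e v a : ev W env e v a -> ev 1 env e v (a * W).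
Proof. by move=> [n h le]; exists n; rewrite ?muln1. Qed.

Lemma app2_take (A : Type) (ea : A -> value) (l : seq A) n env :
  app2 1 (VClos env (TFun take_body)) (VInt n%:Z) (vlist [seq ea x | x <- l])
    (vlist [seq ea x | x <- take n l]) (20 * size (take n l) + 15).
Proof.
have W1 : (0 < 1)%N by [].
elim: l n => [|x l IH] n.
  apply: app2_le; first apply: app2_fun => //.
    apply: (ev_if W1 (b := n%:Z <= 0)).
    - by eapply (ev_prim2 W1); [by apply: ev_var|exact: ev_int|].
    - by move=> _; apply: ev_nil.
    - by move=> _; apply: ev_case_nil => //; [by apply: ev_var|apply: ev_nil].
  by rewrite /=; lia.
case: n => [|n].
  apply: app2_le; first apply: app2_fun => //.
    apply: (ev_if W1 (b := true) (a2 := 0)) => // [|_]; last exact: ev_nil.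
    by eapply (ev_prim2 W1); [by apply: ev_var|exact: ev_int|].
  by rewrite /=; lia.
apply: app2_le; first apply: app2_fun => //.
  apply: (ev_if W1 (b := false) (a1 := 0)) => // [|_].
    by eapply (ev_prim2 W1); [by apply: ev_var|exact: ev_int|].
  eapply ev_case_cons => //; first by apply: ev_var.
  apply: ev_cons => //; first by apply: ev_var.
  eapply (ev_app2 W1); [by apply: ev_var| |by apply: ev_var|exact: (IH n)].
  eapply (ev_prim2 W1); [by apply: ev_var|exact: ev_int|].
  by rewrite /= -addn1 PoszD addrK.
by rewrite /=; lia.
Qed.

Lemma ev_nonleaf us env i : onth env i = Some (vtrees us) ->
  ev (size us).+1 env (tnonleaf i) (VBool (has (fun u => ~~ nilp (echildren u)) us)) 50.
Proof.
move=> hi; apply: ev_le.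
  apply: (@ev_has _ _ _ _ (@VTree R U) 1 (size us).+1) => //; first by rewrite muln1.
    by apply: ev_var.
  move=> u w1 w2 w3 _; apply: (ev_case_list (isT : (0 < 1)%N) (ea := @VTree R U) (l := echildren u)) => //.
  - by eapply ev_prim1 => //; [by apply: ev_var|].
  - by move=> ->; apply: ev_bool.
  - by move=> c cs ->; apply: ev_bool.
by [].
Qed.

Lemma ev_step (f : seq (etree U) -> seq (etree U)) tr us j env ius ij :
  (forall u, f [:: u] = [:: u]) ->
  (forall u c cs acc w1 w2, echildren u = c :: cs ->
     ev (size (f (echildren u))).+1
       (VTree c :: vtrees cs :: acc :: w1 :: VTree u :: w2 :: env) tr
       (vtrees (f (echildren u))) 60) ->
  onth env ius = Some (vtrees us) -> onth env ij = Some (VInt j) ->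
  ev 1 env (tstep tr ius ij) (vtrees (flatten [seq f (expand j u) | u <- us]))
    (150 * (size us + size (flatten [seq f (expand j u) | u <- us])) + 20).
Proof.
move=> f1 htr hus hj; have W1 : (0 < 1)%N by [].
have -> : flatten [seq f (expand j u) | u <- us] =
    foldr (fun u acc => f (expand j u) ++ acc) [::] us.
  by elim: (us) => //= ? ? ->.
apply: ev_le.
  apply: (ev_foldr_sum W1 (ea := @VTree R U) (eb := fun us => vtrees us)
    (c := fun u => 130 * (size (f (expand j u))).+1)%N).
  - exact: ev_fun.
  - exact: ev_nil.
  - by apply: ev_var hus.
  - move=> s1 u s2 _; set acc := foldr _ _ s2.
    apply: app2_le; first apply: app2_fun => //.
      apply: (ev_unit (W := (size (f (expand j u))).+1) (a := 120)).
      rewrite /expand; case cE: (echildren u) => [|c cs].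
        rewrite f1; apply: ev_le.
          apply: ev_case_nil => //.
            by eapply ev_prim1 => //; [by apply: ev_var|rewrite /= cE].
          by apply: ev_cons => //; apply: ev_var.
        by [].
      apply: ev_le.
        eapply ev_case_cons => //.
          by eapply ev_prim1 => //; [by apply: ev_var|rewrite /= cE].
        apply: (ev_if (ltn0Sn _) (b := j <= elevel c + 1)).
        + eapply ev_prim2 => //; first by apply: ev_var => //; exact: hj.
            eapply ev_prim2 => //; [|exact: ev_int|].
              by eapply ev_prim1 => //; [by apply: ev_var|].
            by [].
          by [].
        + move=> ->; apply: ev_cat => //; first by rewrite -cE; apply: htr.
          by apply: ev_var.
        + by move=> /negbTE->; rewrite f1; apply: ev_cons => //; apply: ev_var.
      by [].
    by lia.
rewrite (_ : foldr _ _ _ = flatten [seq f (expand j u) | u <- us]); last first.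
  by elim: (us) => //= ? ? ->.
rewrite size_flatten /shape.
have -> : sumn [seq (130 * (size (f (expand j u))).+1)%N | u <- us] =
    (130 * (size us + sumn [seq size s | s <- [seq f (expand j u) | u <- us]]))%N.
  by elim: (us) => //= u s ->; lia.
by move: (sumn _) (size us) => a b; lia.
Qed.

End Descent.

Lemma has_In (A : Type) (p : pred A) (s : seq A) :
  has p s <-> exists2 x, List.In x s & p x.
Proof.
elim: s => /= [|a s IH]; first by split=> // -[].
split=> [/orP[pa|/IH[x xs px]]|[x [<-|xs] px]]; [by exists a; [left|]| | by rewrite px|].
  by exists x => //; right.
by apply/orP; right; apply/IH; exists x.
Qed.

Definition leaves (U : Type) (us : seq (etree U)) : Prop :=
  forall u, List.In u us -> echildren u = [::].

Lemma leavesPn (U : Type) (us : seq (etree U)) :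
  ~~ has (fun u => ~~ nilp (echildren u)) us <-> leaves us.
Proof.
split=> [/negP h u uus|lv].
  by apply/nilP; apply: contra_notT h => nl; apply/has_In; exists u.
by apply/negP => /has_In[u /lv->].
Qed.

Section Phases.
Context (R : realType) (U : metricType R) (S : {fset U}) (T : cover_tree U) (t : etree U).
Hypothesis Tct : is_cover_tree S T.
Context (orc : pred {fset U}).
Local Notation value := (value R U).
Local Notation ev := (ev orc).
Local Notation app2 := (app2 orc).
Local Notation vtrees s := (vlist [seq VTree u | u <- s] : value).
Implicit Types (env : seq value) (us : seq (etree U)) (j : int).

Lemma ev_conv W W' env e v a a' :
  ev W env e v a -> (a * W <= a' * W')%N -> ev W' env e v a'.
Proof. by move=> [n h le] le'; exists n => //; apply: leq_trans le'. Qed.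

Lemma size_take_level k j us :
  let ns := flatten [seq take k.+1 (expand j u) | u <- us] in
  [/\ (size ns <= size us * k.+1)%N, (size ns <= size (next_level j us))%N &
      (size ns <= k)%N -> ns = next_level j us].
Proof.
rewrite /next_level; elim: us => //= u us [IH1 IH2 IH3]; rewrite !size_cat; split.
- by rewrite mulSn leq_add // size_take_min geq_minl.
- by rewrite leq_add // size_take_min geq_minr.
- move=> le; rewrite IH3; last by apply: leq_trans le; rewrite leq_addl.
  congr (_ ++ _); have : (size (take k.+1 (expand j u)) <= k)%N.
    by apply: leq_trans le; rewrite leq_addr.
  rewrite size_take_min; case: (leqP k.+1 (size (expand j u))) => [_|h _].
    by rewrite ltnn.
  by rewrite take_oversize // ltnW.
Qed.

Lemma app2_phase1 k env iK :
  onth env iK = Some (VInt k.+1%:Z) ->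
  forall g us j, frontier T t j us -> (size us <= k)%N ->
  (forall us', frontier T t (j - g%:Z) us' -> leaves us') ->
  exists us' j', [/\ app2 k.+1 (VClos env (TFun (phase1_body iK))) (vtrees us) (VInt j)
      (VCons (vtrees us') (VInt j')) (2000 * g + 2000 * k.+1),
    frontier T t j' us', (size us' <= k)%N &
    leaves us' \/ (k < size (next_level j' us'))%N].
Proof.
move=> hK; have K0 : (0 < k.+1)%N by [].
elim=> [|g IH] us j fr szus lv.
  exists us, j; have lus : leaves us by apply: lv; rewrite subr0.
  split; auto; apply: app2_le; first apply: app2_fun => //.
    apply: (ev_if K0 (b := has (fun u => ~~ nilp (echildren u)) us) (a1 := 0)).
    + by apply: (@ev_weak _ _ _ (size us).+1) => //; apply: ev_nonleaf.
    + by move=> nl; have /negP[] := (leavesPn us).2 lus.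
    + by move=> _; apply: ev_cons => //; apply: ev_var.
  by lia.
have [nl|/leavesPn lus] := boolP (has (fun u => ~~ nilp (echildren u)) us); last first.
  exists us, j; split; auto; apply: app2_le; first apply: app2_fun => //.
    apply: (ev_if K0 (b := has (fun u => ~~ nilp (echildren u)) us) (a1 := 0)).
    + by apply: (@ev_weak _ _ _ (size us).+1) => //; apply: ev_nonleaf.
    + by move=> nl; have /negP[] := (leavesPn us).2 lus.
    + by move=> _; apply: ev_cons => //; apply: ev_var.
  by lia.
pose ns := flatten [seq take k.+1 (expand j u) | u <- us].
have [le1 le2 nsE] := size_take_level k j us; rewrite -/ns in le1 le2 nsE.
have step w1 w2 : ev 1 [:: VInt j, w1, vtrees us, w2 & env]
    (tstep (TApp (TApp take_term (TVar iK.+4.+4.+2)) (TPrim1 PChildren (TVar 4))) 2 0)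
    (vtrees ns) (150 * (size us + size ns) + 20).
  apply: ev_step => // u c cs acc w3 w4 _.
  apply: (@ev_conv 1 _ _ _ _ (20 * size (take k.+1 (echildren u)) + 25)); last by lia.
  apply: ev_le.
    eapply (ev_app2 (ltn0Sn 0)); [exact: ev_fun| | |exact: app2_take].
      by apply: ev_var => //; exact: hK.
    by eapply ev_prim1 => //; [by apply: ev_var|].
  by lia.
have [small|big] := leqP (size ns) k; last first.
  exists us, j; split=> //; last by right; apply: leq_trans big le2.
  apply: app2_le; first apply: app2_fun => //.
    apply: (ev_if K0 (b := true) (a2 := 0)) => // [|_].
      by rewrite -nl; apply: (@ev_weak _ _ _ (size us).+1) => //; apply: ev_nonleaf.
    apply: (@ev_let _ _ _ _ K0 _ _ _ _ _ (300 * k.+1)).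
      by apply: (@ev_conv 1); [exact: step|nia].
    apply: (ev_if K0 (b := true) (a2 := 0)) => // [|_].
      eapply ev_prim2 => //; first by apply: ev_var => //; exact: hK.
        apply: (@ev_conv (k.+1 * k.+1) _ _ _ _ 40 (40 * k.+1)); last by rewrite mulnA.
        apply: (@ev_le _ _ _ _ _ _ _ (1 + 34)) => //.
        apply: (ev_length (ea := @VTree R U)) => //; last by apply: ev_var.
        by apply: leq_trans le1 _; rewrite leq_mul // ltnW.
      by rewrite /= lez_nat big.
    by apply: ev_cons => //; apply: ev_var.
  by lia.
have {}nsE := nsE small; rewrite nsE in step small.
have {}lv us' : frontier T t (j - 1 - g%:Z) us' -> leaves us'.
  by rewrite (_ : j - 1 - g%:Z = j - g.+1%:Z); [apply: lv|lia].
have [us' [j' [app' fr' sz' or']]] := IH _ _ (frontier_next Tct fr) small lv.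
exists us', j'; split=> //; apply: app2_le; first apply: app2_fun => //.
  apply: (ev_if K0 (b := true) (a2 := 0)) => // [|_].
    by rewrite -nl; apply: (@ev_weak _ _ _ (size us).+1) => //; apply: ev_nonleaf.
  apply: (@ev_let _ _ _ _ K0 _ _ _ _ _ 300).
    by apply: (@ev_conv 1); [exact: step|lia].
  apply: (ev_if K0 (b := false) (a1 := 0)) => // [|_].
    eapply ev_prim2 => //; first by apply: ev_var => //; exact: hK.
      apply: (ev_length (ea := @VTree R U)) => //; last by apply: ev_var.
      exact: ltnW.
    by rewrite /= lez_nat leqNgt ltnS small.
  eapply (ev_app2 K0); [by apply: ev_var|by apply: ev_var| |exact: app'].
  by eapply ev_prim2 => //; [by apply: ev_var|by apply: ev_int|].
by lia.
Qed.

Lemma app2_phase2 N (B : R) env : (0 < N)%N -> 1 <= B ->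
  (forall j us, frontier T t j us -> (size (next_level j us))%:R <= B * (size us)%:R) ->
  forall m us j (q : R), frontier T t j us -> (leaves us \/ 1 <= 2 ^+ m * q) ->
  (size us)%:R * B ^+ m < N%:R ->
  exists us' i, [/\ app2 N (VClos env (TFun phase2_body)) (VCons (vtrees us) (VInt j)) (VReal q)
      (vtrees us') (1000 * m.+1),
    frontier T t (j - i%:Z) us', leaves us' \/ ~ leaves us /\ 1 <= 2 ^+ i * q &
    (size us' < N)%N].
Proof.
move=> N0 B1 grow.
have szN m us : (size us)%:R * B ^+ m < N%:R -> (size us < N)%N.
  move=> h; rewrite -(ltr_nat R); apply: le_lt_trans h.
  by rewrite ler_peMr // exprn_ege1.
elim=> [|m IH] us j q fr stop szus; have szusN := szN _ _ szus.
- exists us, 0%N; rewrite subr0; split=> //; last first.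
    by have [lus|nlus] := pselect (leaves us); [left|right; split=> //; case: stop].
  apply: app2_le; first apply: app2_fun => //.
    apply: ev_let => //; first by apply: ev_fst => //; apply: ev_var.
    apply: ev_let => //; first by apply: ev_snd => //; apply: ev_var.
    apply: (ev_if N0 (b := has (fun u => ~~ nilp (echildren u)) us)).
    + by apply: (@ev_weak _ _ _ (size us).+1) => //; apply: ev_nonleaf.
    + move=> nl; apply: (ev_if N0 (b := true) (a2 := 0)) => // [|_]; last by apply: ev_var.
      eapply ev_prim2 => //; [by eapply ev_prim1 => //; [by apply: ev_int|]|by apply: ev_var|].
      case: stop => [/leavesPn|]; first by rewrite nl.
      by rewrite expr0 mul1r => /= ->.
    + by move=> _; apply: ev_var.
  by [].
have [done_|/negP go] := boolP (has (fun u => ~~ nilp (echildren u)) us ==> (1 <= q)).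
- exists us, 0%N; rewrite subr0 expr0 mul1r; split=> //; last first.
    have [nl|/leavesPn] := boolP (has (fun u => ~~ nilp (echildren u)) us); auto.
    by right; split; [move/leavesPn; rewrite nl|rewrite nl in done_].
  apply: app2_le; first apply: app2_fun => //.
    apply: ev_let => //; first by apply: ev_fst => //; apply: ev_var.
    apply: ev_let => //; first by apply: ev_snd => //; apply: ev_var.
    apply: (ev_if N0 (b := has (fun u => ~~ nilp (echildren u)) us)).
    + by apply: (@ev_weak _ _ _ (size us).+1) => //; apply: ev_nonleaf.
    + move=> nl; apply: (ev_if N0 (b := true) (a2 := 0)) => // [|_]; last by apply: ev_var.
      eapply ev_prim2 => //; [by eapply ev_prim1 => //; [by apply: ev_int|]|by apply: ev_var|].
      by rewrite nl /= in done_; rewrite /= done_.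
    + by move=> _; apply: ev_var.
  by lia.
have {go} [nl nq] : has (fun u => ~~ nilp (echildren u)) us /\ (1 <= q) = false.
  by case: (has _ us) go => //; case: (1 <= q).
set ns := next_level j us.
have szB : (size ns)%:R * B ^+ m < N%:R.
  apply: le_lt_trans szus; rewrite exprS mulrA (mulrC _ B) ler_wpM2r ?grow //.
  by rewrite exprn_ge0 // (le_trans ler01).
have szns := szN _ _ szB.
have stop' : leaves ns \/ 1 <= 2 ^+ m * (q + q).
  case: stop => [/leavesPn|]; first by rewrite nl.
  by rewrite exprSr -mulrA mulr_natl mulr2n; right.
have [us' [i [app' fr' or' sz']]] := IH _ _ _ (frontier_next Tct fr) stop' szB.
exists us', i.+1; split=> //; last 2 first.
- by rewrite (_ : j - i.+1%:Z = j - 1 - i%:Z) //; clear; lia.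
- case: or' => [|[_ h]]; [by left|right; rewrite exprSr -mulrA mulr_natl mulr2n].
  by split=> // /leavesPn; rewrite nl.
apply: app2_le; first apply: app2_fun => //.
  apply: ev_let => //; first by apply: ev_fst => //; apply: ev_var.
  apply: ev_let => //; first by apply: ev_snd => //; apply: ev_var.
  apply: (ev_if N0 (b := true) (a2 := 0)) => // [|_].
    by rewrite -nl; apply: (@ev_weak _ _ _ (size us).+1) => //; apply: ev_nonleaf.
  apply: (ev_if N0 (b := false) (a1 := 0)) => // [|_].
    eapply ev_prim2 => //; [by eapply ev_prim1 => //; [by apply: ev_int|]|by apply: ev_var|].
    by rewrite /= nq.
  eapply (ev_app2 N0); [by apply: ev_var| | |exact: app'].
    apply: ev_cons => //; last first.
      by eapply ev_prim2 => //; [by apply: ev_var|by apply: ev_int|].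
    apply: (@ev_conv 1 _ _ _ _ (150 * (size us + size ns) + 20) 320); last first.
      by move: szusN szns N0; clear; lia.
    have -> : ns = flatten [seq id (expand j u) | u <- us] by [].
    apply: (ev_step (f := id)) => // u c cs acc w1 w2 _.
    apply: (@ev_le _ _ _ _ _ _ _ 2) => //.
    by eapply ev_prim1 => //; [by apply: ev_var|].
  by eapply ev_prim2 => //; [by apply: ev_var|by apply: ev_var|].
by clear; lia.
Qed.

End Phases.

(* The left-hand side is the sum of the costs of the parts of [program]. *)
Lemma descent_cost (g m K N2 N Y X : nat) :
  (0 < X -> K <= X -> N2 <= X -> N <= X -> Y <= X ->
  (2 +
   ((36 * K + 1).+1 +
    ((2 + 2 + (2 + 1).+1).+1 +
     ((10 + 2000 * g + 2000 * K) * K +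
      ((10 + 1000 * m.+1) * N2 +
       (40 * N + (120 * Y + 4800 * X).+1).+1).+1).+1).+1).+1).+1 <=
   2000 * (g * K + K * K + m.+1 * N2 + 3 * X))%N.
Proof.
have -> : ((10 + 2000 * g + 2000 * K) * K = 10 * K + 2000 * (g * K + K * K))%N.
  by rewrite mulnDl mulnDl mulnDr !mulnA addnA.
have -> : ((10 + 1000 * m.+1) * N2 = 10 * N2 + 1000 * (m.+1 * N2))%N.
  by rewrite mulnDl mulnA.
by move: (g * K + K * K)%N (m.+1 * N2)%N => a b; lia.
Qed.

Section Program.
Context (R : realType) (U : metricType R) (S : {fset U}) (M : matroid S).
Context (T : cover_tree U) (t : etree U).
Hypothesis Tct : is_cover_tree S T.
Hypothesis Tt : explicit_representation T t.
Local Notation value := (value R U).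
Local Notation ev := (ev (indep M)).

Lemma ev_program k g m N2 (B eps : R) :
  (0 < k)%N -> size (emis t) = k -> (forall u, node_of u t -> (size (emis u) <= k)%N) ->
  (forall us, frontier T t (start_level t - g%:Z) us -> leaves us) ->
  1 <= B ->
  (forall j us, frontier T t j us -> (size (next_level j us))%:R <= B * (size us)%:R) ->
  ((forall j us, frontier T t j us -> leaves us) \/ 1 <= 2 ^+ m * eps) ->
  k%:R * B ^+ m < N2%:R ->
  exists us1 us2 j i, [/\ ev 1 [:: VTree t; VReal eps] program
      (vpoints R (cluster (fun s => indep M [fset x in s])
         [seq epoint u | u <- us2] (flatten [seq emis u | u <- us2])))
      (2000 * (g * k.+1 + k.+1 * k.+1 + m.+1 * N2 + 3 * (N2 * k.+1) ^ 9)),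
    frontier T t j us1 /\ (size us1 <= k)%N,
    leaves us1 \/ (k < size (next_level j us1))%N,
    frontier T t (j - i%:Z) us2 /\ (size us2 < N2)%N &
    leaves us2 \/ ~ leaves us1 /\ 1 <= 2 ^+ i * eps].
Proof.
move=> k0 tk misk lv B1 grow stop szN; have W1 : (0 < 1)%N by [].
have N20 : (0 < N2)%N.
  rewrite -(ltr_nat R); apply: le_lt_trans szN.
  by rewrite mulr_ge0 // exprn_ge0 // (le_trans ler01).
pose env := [:: VInt k.+1%:Z; VPoint (head (epoint t) (emis t));
  vpoints R (behead (emis t)); VTree t; VReal eps] : seq value.
have [us1 [j [app1 fr1 sz1 or1]]] := @app2_phase1 _ _ _ _ _ Tct (indep M) k
  (VInt (start_level t) :: env) 1 erefl g [:: t] (start_level t) (frontier_start Tct Tt) k0 lv.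
have stop1 : leaves us1 \/ 1 <= 2 ^+ m * eps by case: stop => [/(_ _ _ fr1)|]; auto.
have sz1' : (size us1)%:R * B ^+ m < N2%:R.
  apply: le_lt_trans szN; rewrite ler_wpM2r ?ler_nat //.
  by rewrite exprn_ge0 // (le_trans ler01).
pose env2 := VCons (vlist [seq VTree u | u <- us1]) (VInt j) :: VInt (start_level t) :: env.
have [us2 [i [app2_ fr2 or2 sz2]]] := @app2_phase2 _ _ _ _ _ Tct (indep M) N2 B env2
  N20 B1 grow m us1 j eps fr1 stop1 sz1'.
exists us1, us2, j, i; split=> //.
set P := [seq epoint u | u <- us2]; set Q := flatten [seq emis u | u <- us2].
pose N := (N2 * k.+1)%N; have N0 : (0 < N)%N by rewrite muln_gt0 N20.
have leN2 : (N2 <= N)%N by rewrite leq_pmulr.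
have leKN : (k.+1 <= N)%N by rewrite leq_pmull.
have szP : (size P < N)%N by rewrite size_map (leq_trans sz2).
have szQ : (size Q <= N)%N.
  have [_ _ _ at_] := fr2.
  apply: (@leq_trans (size us2 * k)); last by rewrite leq_mul // ltnW.
  rewrite /Q; elim: (us2) at_ => //= u us IH at_; rewrite size_cat mulSn.
  rewrite leq_add ?IH // => [|v vus]; last by apply: at_; right.
  by apply: misk; case: (at_ u (or_introl erefl)).
have le2 : (N <= N ^ 2)%N by rewrite -mulnn leq_pmulr.
have le9 : (N <= N ^ 9)%N by rewrite -[leqLHS]expn1 leq_pexp2l.
have le29 : (N ^ 2 <= N ^ 9)%N by rewrite leq_pexp2l.
rewrite /program; apply: ev_le.
  apply: (@ev_case_cons _ _ _ _ W1 _ _ _ _ (VPoint (head (epoint t) (emis t)))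
    (vpoints R (behead (emis t)))).
    eapply (ev_prim1 W1); first by apply: ev_var.
    by rewrite /=; case: (emis t) tk k0 => //= <-.
  apply: (ev_let W1 (v1 := VInt k.+1%:Z)).
    eapply (ev_prim2 W1); [|exact: ev_int|].
      apply: (@ev_conv _ _ _ k.+1 1 _ _ _ 36 (36 * k.+1)); last by rewrite muln1.
      apply: (@ev_le _ _ _ _ _ _ _ (2 + 34)) => //.
      apply: (ev_length (ea := @VPoint R U) (l := emis t)); rewrite ?tk //.
      by eapply ev_prim1 => //; [by apply: ev_var|].
    by rewrite /= tk -addn1 PoszD.
  rewrite -/env; apply: (ev_let W1 (v1 := VInt (start_level t))).
    apply: (ev_case_list W1 (ea := @VTree R U) (l := echildren t)).
    - by eapply (ev_prim1 W1); [by apply: ev_var|].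
    - move=> tE; eapply (ev_prim1 W1); first by apply: ev_var.
      by rewrite /start_level tE.
    - move=> c cs tE; eapply (ev_prim2 W1); [|exact: ev_int|].
        by eapply (ev_prim1 W1); [by apply: ev_var|].
      by rewrite /start_level tE.
  apply: (ev_let W1 (v1 := VCons (vlist [seq VTree u | u <- us1]) (VInt j))
    (a1 := (10 + 2000 * g + 2000 * k.+1) * k.+1)).
    apply: ev_unit; apply: ev_le.
      eapply (ev_app2 (ltn0Sn k)); [exact: ev_fun| | |exact: app1].
        by apply: ev_cons => //; [by apply: ev_var|by apply: ev_nil].
      by apply: ev_var.
    by clear; lia.
  apply: (ev_let W1 (v1 := vlist [seq VTree u | u <- us2])
    (a1 := (10 + 1000 * m.+1) * N2)).
    apply: ev_unit; apply: ev_le.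
      by eapply (ev_app2 N20); [exact: ev_fun|by apply: ev_var|by apply: ev_var|exact: app2_].
    by clear; lia.
  apply: (ev_let W1 (v1 := vlist [seq VPoint p | p <- P]) (a1 := 40 * N)).
    apply: ev_unit; apply: (@ev_le _ _ _ _ _ _ _ (1 + 2 + 33)) => //.
    apply: (ev_map (ea := @VTree R U) (eb := @VPoint R U) (W := 1) (W' := N)) => //.
    - by rewrite muln1 (leq_trans (ltnW sz2)).
    - by apply: ev_var.
    - by move=> u w1 w2 w3 _; eapply ev_prim1 => //; [by apply: ev_var|].
  apply: (ev_let W1 (v1 := vlist [seq VPoint p | p <- Q]) (a1 := 120 * N ^ 2)).
    apply: ev_unit; apply: (@ev_le _ _ _ _ _ _ _ (1 + 2 + 33 + 66)) => //.
    have N20' : (0 < N ^ 2)%N by rewrite expn_gt0 N0.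
    apply: (ev_flatten (ea := @VPoint R U) (W := N)) => //.
    - by rewrite size_map -mulnn leq_mul // (leq_trans (ltnW sz2)).
    - move=> l /In_map[u uus ->]; have [_ _ _ /(_ _ uus)[_ nu]] := fr2.
      by rewrite (leq_trans (misk _ nu)) // (leq_trans _ leKN).
    - apply: (ev_map (ea := @VTree R U) (W := 1) (W' := N ^ 2)
        (eb := fun s => vlist [seq VPoint x | x <- s])) => //.
      + by rewrite muln1 (leq_trans (ltnW sz2)) // (leq_trans leN2).
      + by apply: ev_var.
      + by move=> u w1 w2 w3 _; eapply ev_prim1 => //; [by apply: ev_var|].
  by apply: ev_unit; apply: (ev_cluster M N0 szP szQ).
rewrite -/N; apply: descent_cost => //; first by rewrite expn_gt0 N0.
- exact: leq_trans leKN le9.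
- exact: leq_trans leN2 le9.
Qed.

End Program.

(** * Bounds on the radius and on the number of steps *)

Section Bounds.
Context (R : realType) (U : metricType R) (S : {fset U}).

Lemma max_indep_card (M : matroid S) (A C : {fset U}) :
  max_indep M S A -> indep M C -> (#|` C| <= #|` A|)%N.
Proof.
move=> mA iC; have [_ iA _] := mA; rewrite leqNgt; apply/negP => lt.
have [x /fsetDP[xC xA] ixA] := indep_exchange iA iC lt.
by have /negP[] := max_indep_notin mA (fsubsetP (indep_sub iC) _ xC) xA.
Qed.

Lemma aspect_ratio_ge1 p q : p \in S -> q \in S -> p != q -> 1 <= aspect_ratio S.
Proof.
move=> pS qS pq; rewrite /aspect_ratio ler_pdivlMr ?(min_dist_gt0 pS qS) // mul1r.
exact: le_trans (min_dist_le pS qS pq) (le_max_dist pS qS).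
Qed.

Lemma aspect_ratio_singleton (p : U) : @aspect_ratio R U [fset p] = 0.
Proof.
rewrite /aspect_ratio /max_dist big_seq bigmax_eq_id ?mul0r // => x.
rewrite in_fset1 => /eqP->; rewrite big_seq; apply: bigmax_le => // y.
by rewrite in_fset1 => /eqP->; rewrite mdistxx.
Qed.

Context (T : cover_tree U) (t : etree U).
Hypothesis Tct : is_cover_tree S T.
Hypothesis Tt : explicit_representation T t.

Lemma leaves_singleton j us : echildren t = [::] -> frontier T t j us -> leaves us.
Proof.
move=> tE fr u uus; apply: contrapT => ne.
have [p [q [pS qS /negP[]]]] := nonleaf_dist Tct fr uus ne.
rewrite -(subtree_root Tct Tt) in pS qS.
by rewrite (leaf_subtree tE pS) (leaf_subtree tE qS).
Qed.

Lemma depth_bound : exists g : nat,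
  [/\ forall us, frontier T t (start_level t - g%:Z) us -> leaves us,
      0 <= ln (aspect_ratio S) & g%:R * ln 2 <= 2 * ln 2 + ln (aspect_ratio S)].
Proof.
have ln2 : 0 < ln 2 :> R by rewrite ln_gt0 // (ltr_nat R 1 2).
have [tE|tE] := pselect (echildren t = [::]).
  exists 0%N; have -> : S = [fset epoint t].
    apply/fsetP => q; rewrite -(subtree_root Tct Tt) in_fset1.
    by apply/idP/eqP => [/(leaf_subtree tE)|->]; last exact: subtree_points_self.
  rewrite aspect_ratio_singleton ln0 // mul0r; split=> // [us|]; first exact: leaves_singleton.
  by rewrite addr0 mulr_ge0 // ltW.
have [p [q [pS qS dpq]]] := start_dist Tct Tt tE.
have pq : p != q by rewrite -mdist_gt0 (lt_trans _ dpq) // exp2_gt0.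
have asp1 := aspect_ratio_ge1 pS qS pq; have min0 := min_dist_gt0 pS qS pq.
have lt_max : 2 ^ start_level t < 2 * max_dist S :> R.
  have := exp2S R (start_level t - 1); rewrite subrK => ->.
  by rewrite ltr_pM2l // (lt_le_trans dpq) // le_max_dist.
have ex : exists g, 2 ^ start_level t < 2 ^+ g * min_dist S.
  exists (Num.truncn (2 ^ start_level t / min_dist S)).+1.
  rewrite -ltr_pdivrMr //; apply: lt_le_trans (truncnS_gt _) _.
  by rewrite -natrX ler_nat ltnW // ltn_expl.
have [g gP gmin] := ex_minnP ex; exists g; split.
- move=> us fr u uus; apply: contrapT => ne.
  have [x [y [xS yS xy d]]] := nonleaf_dist Tct fr uus ne.
  have := le_trans (min_dist_le xS yS xy) d.
  rewrite expfzDr ?pnatr_eq0 // leNgt => /negP; apply.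
  by rewrite -exprnN ltr_pdivrMr ?exprn_gt0 // mulrC.
- by rewrite ln_ge0.
- have lt4 : 2 ^+ g < 2 ^+ 2 * aspect_ratio S.
    case: g gP gmin => [|g] gP gmin.
      by rewrite expr0; move: asp1; rewrite expr2; lra.
    have : ~~ (2 ^ start_level t < 2 ^+ g * min_dist S).
      by apply/negP => /gmin; rewrite ltnn.
    rewrite -leNgt /aspect_ratio mulrA ltr_pdivlMr // exprS -mulrA => le.
    by rewrite expr2 -mulrA ltr_pM2l // (le_lt_trans le).
  have asp0 := lt_le_trans ltr01 asp1.
  have : ln (2 ^+ g) < ln (2 ^+ 2 * aspect_ratio S).
    have h0 : (0 : R) < 2 ^+ g by rewrite exprn_gt0.
    have h1 : (0 : R) < 2 ^+ 2 * aspect_ratio S by rewrite mulr_gt0 // exprn_gt0.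
    by rewrite ltr_ln ?posrE.
  by rewrite lnM ?posrE ?exprn_gt0 // !lnXn // -[ln 2 *+ g]mulr_natl -[ln 2 *+ 2]mulr_natl => /ltW.
Qed.

End Bounds.

Section Main.
Context (R : realType) (U : metricType R) (S : {fset U}) (M : matroid S).
Context (T : cover_tree U) (t : etree U) (k : nat).
Hypothesis Tct : is_cover_tree S T.
Hypothesis Tt : explicit_representation T t.
Hypothesis Taug : augmented M t.
Hypothesis Mk : matroid_rank M k.

Lemma root_mis : max_indep M S [fset x in emis t] /\ size (emis t) = k.
Proof.
have [_ uniq_mis] := Taug (node_of_root t); rewrite (subtree_root Tct Tt) => mA.
by split=> //; rewrite -(Mk mA) card_fseq undup_id.
Qed.

Lemma indep_le_rank C : indep M C -> (#|` C| <= k)%N.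
Proof.
have [mA szA] := root_mis => iC; apply: leq_trans (max_indep_card mA iC) _.
by rewrite card_fseq -szA size_undup.
Qed.

Lemma size_mis u : node_of u t -> (size (emis u) <= k)%N.
Proof.
move=> /Taug[_ uniq_mis [_ iA _]].
by have := indep_le_rank iA; rewrite card_fseq undup_id.
Qed.

(* The next level of the last small frontier has more nodes than the rank, so
   that the optimal radius is at least half its separation. *)
Lemma descent_radius rho (C : {fset U}) j i us1 us2 (eps : R) :
  0 <= rho -> 0 < eps -> indep M C ->
  (forall p, p \in S -> exists2 c, c \in C & mdist p c <= rho) ->
  frontier T t j us1 -> leaves us1 \/ (k < size (next_level j us1))%N ->
  frontier T t (j - i%:Z) us2 -> leaves us2 \/ ~ leaves us1 /\ 1 <= 2 ^+ i * eps ->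
  exists2 d, 0 <= d <= 8 * eps * rho & forall u q,
    List.In u us2 -> q \in subtree_points u -> mdist (epoint u) q <= d.
Proof.
move=> rho0 eps0 iC cov fr1 or1 fr2 [lus2|[nlus1 ieps]].
  exists 0; first by rewrite lexx /= !mulr_ge0 // ltW.
  by move=> u q /lus2 uE qu; rewrite (leaf_subtree uE qu) mdistxx.
have {or1} big : (k < size (next_level j us1))%N by case: or1.
have [_ un me _] := frontier_next Tct fr1.
have sep : 2 ^ (j - 1) < 2 * rho.
  apply: (@packing_radius _ _ [seq epoint u | u <- next_level j us1] C) => //.
  - by rewrite size_map (leq_ltn_trans (indep_le_rank iC)).
  - by move=> p q; rewrite !me => pl ql pq; apply: (ct_sep Tct pl ql pq).
  - by move=> p; rewrite me => /(ct_points_in Tct)/cov.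
exists (2 ^ (j - i%:Z + 1)); last first.
  by move=> u q uus qu; case: (frontier_subtree Tct fr2 uus qu).
rewrite (ltW (exp2_gt0 _ _)) /=.
have i0 : 0 < 2 ^+ i :> R by rewrite exprn_gt0.
have -> : 2 ^ (j - i%:Z + 1) = 4 * 2 ^ (j - 1) / 2 ^+ i :> R.
  rewrite (_ : j - i%:Z + 1 = (j - 1 + 1 + 1) + - i%:Z); last by lia.
  by rewrite expfzDr ?pnatr_eq0 // -exprnN !exp2S; congr (_ / _); lra.
rewrite ler_pdivrMr //; apply: le_trans (_ : 8 * rho * (2 ^+ i * eps) <= _); last by lra.
apply: (@le_trans _ _ (8 * rho)); first by lra.
by rewrite ler_peMr // mulr_ge0.
Qed.

Lemma cluster_radius rho (C : {fset U}) j us (d : R) :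
  0 <= d -> indep M C ->
  (forall p, p \in S -> exists2 c, c \in C & mdist p c <= rho) ->
  frontier T t j us ->
  (forall u q, List.In u us -> q \in subtree_points u -> mdist (epoint u) q <= d) ->
  let s := cluster (fun s => indep M [fset x in s])
    [seq epoint u | u <- us] (flatten [seq emis u | u <- us]) in
  indep M [fset x in s] /\
  (cover_radius S [fset x in s] <= (3 * rho + 7 * d)%:E)%E.
Proof.
move=> d0 iC cov fr near s.
have [_ _ _ at_] := fr.
have grp x : x \in S -> exists Y A, [/\ max_indep M Y A, x \in Y,
     forall a, a \in A -> a \in flatten [seq emis u | u <- us] &
     forall a, a \in A -> mdist x a <= d + d].
  move=> /(frontier_cover Tct fr)[u uus xu].
  have [_ _ mA] := Taug (proj2 (at_ _ uus)); have [AY _ _] := mA.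
  exists (subtree_points u), [fset x in emis u]; split=> // a aA.
    apply/flattenP; exists (emis u); last by move: aA; rewrite !inE.
    by apply/mem_In/In_map; exists u.
  apply: le_trans (metric_triangle x (epoint u) a) _.
  by rewrite (metric_sym x) lerD // near //; apply: (fsubsetP AY).
have [C' [iC' C'Q] C'd] := indep_proxy grp (addr_ge0 d0 d0) iC.
have pS u : List.In u us -> epoint u \in S.
  by move=> uus; have := frontier_point fr uus; apply: (ct_points_in Tct).
have P0 : [seq epoint u | u <- us] != [::].
  have [u uus _] := frontier_cover Tct fr (ct_points_in Tct (frontier_point (frontier_root Tct Tt) (or_introl erefl))).
  by case: (us) uus.
have cov' p : p \in [seq epoint u | u <- us] -> exists2 x, x \in C' & mdist p x <= rho + (d + d).
  move=> /mem_In/In_map[u uus ->]; have [c cC pc] := cov _ (pS _ uus).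
  have [y yC' cy] := C'd _ cC; exists y => //.
  by apply: le_trans (metric_triangle _ c _) _; rewrite lerD.
have [is_ cov_s] := cluster_correct P0 iC' C'Q cov'.
split=> //; apply: cover_radius_le => q /(frontier_cover Tct fr)[u uus qu].
have [x xs ux] : exists2 x, x \in s & mdist (epoint u) x <= 3 * (rho + (d + d)).
  by apply: cov_s; apply/mem_In/In_map; exists u.
exists x; first by rewrite !inE.
have := metric_triangle q (epoint u) x; have := near _ _ uus qu.
by rewrite (metric_sym q (epoint u)); move: ux; lra.
Qed.

Lemma opt_radius_rank0 : k = 0%N -> opt_radius M = +oo%E.
Proof.
move=> k0; have tS : epoint t \in S.
  by rewrite -(subtree_root Tct Tt) subtree_points_self.
rewrite /opt_radius; have [//|[C CS [iC ->]]] := bigmin_seq_attained (fpowerset S) +oo%E (indep M)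
  (fun C => cover_radius S C).
have := indep_le_rank iC; rewrite k0 leqn0 cardfs_eq0 => /eqP->.
apply/eqP; rewrite -leye_eq /cover_radius.
by apply: le_trans (le_bigmax_seq _ (epoint t) xpredT _ tS isT); rewrite big_nil.
Qed.

End Main.

Definition time_poly (R : realType) : {poly {poly R}} :=
  (('X + 2%:R%:P) ^+ 2 * ('X ^+ 2 + 2%:R%:P)%:P) ^+ 9.

Lemma time_polyE (R : realType) (k x : R) :
  (time_poly R).[k%:P].[x] = ((k + 2) ^+ 2 * (x ^+ 2 + 2)) ^+ 9.
Proof. by rewrite /time_poly !hornerE. Qed.

Lemma steps_bound (R : realType) (k g m N2 n : nat) (x L : R) :
  (0 < k)%N -> 0 <= x -> 0 <= L -> m%:R <= x -> N2%:R <= k%:R * (1 + x ^+ 2) + 1 ->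
  g%:R * ln 2 <= 2 * ln 2 + L ->
  (n <= 2000 * (g * k.+1 + k.+1 * k.+1 + m.+1 * N2 + 3 * (N2 * k.+1) ^ 9))%N ->
  n%:R <= 2000%:R * (7 + 2 / ln 2) *
    (((k%:R + 2) ^+ 2 * (x ^+ 2 + 2)) ^+ 9 + k%:R * L).
Proof.
move=> k0 x0 L0 mx N2x gL; rewrite -(ler_nat R) natrM => nle.
apply: le_trans nle _; rewrite -mulrA ler_pM2l ?ltr0n //.
have ln2 : 0 < ln 2 :> R by rewrite ln_gt0 // (ltr_nat R 1 2).
have k1 : 1 <= k%:R :> R by rewrite ler1n.
have gle : g%:R <= 2 + L / ln 2.
  by rewrite -(ler_pM2r ln2) mulrDl -mulrA mulVf ?gt_eqF // mulr1.
set Z := (k%:R + 2) ^+ 2 * (x ^+ 2 + 2).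
have xx : x <= x ^+ 2 + 1 by have := sqr_ge0 (x - 1); rewrite sqrrB expr1n mulr1; lra.
have x2 : 0 <= x ^+ 2 by rewrite exprn_ge0.
have kZ : (k%:R + 2) ^+ 2 * 2 <= Z by rewrite ler_wpM2l ?sqr_ge0 // lerDr.
have Z1 : 1 <= Z by apply: le_trans kZ; rewrite expr2; nra.
have KZ : k.+1%:R <= Z by apply: le_trans kZ; rewrite -natr1 expr2; nra.
have N2Z : N2%:R * k.+1%:R <= Z.
  apply: le_trans (ler_wpM2r (ler0n _ _) N2x) _; rewrite -natr1 /Z expr2.
  by move: x2; set y := x ^+ 2 => y0; nra.
have N2Z' : N2%:R <= Z.
  by apply: le_trans N2Z; rewrite ler_peMr // ler1n.
have mZ : m.+1%:R <= Z.
  rewrite -natr1; apply: (@le_trans _ _ (x ^+ 2 + 2)); first lra.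
  by rewrite ler_peMl ?addr_ge0 // expr2; nra.
have Z0 : 0 <= Z by lra.
have ZZ : Z <= Z ^+ 9 by rewrite -[leLHS]expr1 ler_weXn2l.
have Z2 : Z * Z <= Z ^+ 9 by rewrite -expr2 ler_weXn2l.
rewrite 3!natrD (natrM _ g) (natrM _ k.+1) (natrM _ m.+1) (natrM _ 3) natrX (natrM _ N2).
have t1 : g%:R * k.+1%:R <= 2 * Z ^+ 9 + 2 / ln 2 * (k%:R * L).
  apply: le_trans (ler_wpM2r (ler0n _ _) gle) _; rewrite mulrDl lerD //.
    by rewrite ler_pM2l // (le_trans KZ).
  rewrite -natr1 mulrAC [leRHS]mulrAC ler_wpM2r ?invr_ge0 ?(ltW ln2) //.
  by nra.
have t2 : k.+1%:R * k.+1%:R <= Z ^+ 9 by apply: le_trans Z2; rewrite ler_pM.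
have t3 : m.+1%:R * N2%:R <= Z ^+ 9 by apply: le_trans Z2; rewrite ler_pM.
have t4 : (N2%:R * k.+1%:R) ^+ 9 <= Z ^+ 9.
  by rewrite lerXn2r ?nnegrE // mulr_ge0.
have c0 : 0 <= 2 / ln 2 * Z ^+ 9.
  by apply: mulr_ge0; [rewrite divr_ge0 // ltW|rewrite exprn_ge0].
have kL : 0 <= k%:R * L by rewrite mulr_ge0.
move: t1 t2 t3 t4 c0 kL; set a := g%:R * _; set b := k.+1%:R * _; set c := m.+1%:R * _.
set d := (_ * _) ^+ 9; set Z9 := Z ^+ 9; set l := 2 / ln 2; set e := k%:R * L.
by rewrite mulrDl !mulrDr; lra.
Qed.

Theorem theorem5 (R : realType) :
  exists (prog : term) (c K : R) (P : {poly {poly R}}),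
    0 <= c /\ 0 <= K /\
    forall (U : metricType R) (D : R) (S : {fset U}) (M : matroid S) (k : nat)
           (T : cover_tree U) (t : etree U) (eps : R),
      doubling_dimension U D ->
      matroid_rank M k ->
      0 < eps ->
      is_cover_tree S T ->
      explicit_representation T t ->
      augmented M t ->
      exists (s : seq U) (n : nat),
        [/\ evaluates (indep M) [:: VTree t; VReal eps] prog (vpoints R s) n,
            indep M [fset x in s],
            (cover_radius S [fset x in s] <= (3 + c * eps)%:E * opt_radius M)%E &
            n%:R <= K * (P.[k%:R%:P].[(64 / eps) `^ D]
                         + k%:R * ln (aspect_ratio S))].
Proof.
have ln2 : 0 < ln 2 :> R by rewrite ln_gt0 // (ltr_nat R 1 2).
have K0 : 0 <= 2000%:R * (7 + 2 / ln 2) :> R.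
  by apply: mulr_ge0; rewrite ?ler0n // addr_ge0 ?divr_ge0 // ltW.
exists program, 56, (2000%:R * (7 + 2 / ln 2)), (time_poly R).
split; first by rewrite ler0n.
split; first exact: K0.
move=> U D S M k T t eps dim Mk eps0 Tct Tt Taug.
set x := (64 / eps) `^ D; rewrite time_polyE.
have x0 : 0 <= x by apply: powR_ge0.
have [g [glv L0 gL]] := depth_bound Tct Tt.
have [mA tk] := root_mis Tct Tt Taug Mk.
have [k0|k0] := posnP k.
  exists [::], 4%N; split.
  - rewrite k0 in tk.
    apply: (@eval_case_nil _ _ _ _ _ _ _ _ 2 1); last exact: eval_nil.
    apply: eval_prim1; first exact: eval_var.
    by rewrite /= (size0nil tk).
  - by rewrite (_ : [fset y in _] = fset0) ?indep0 //; apply/fsetP => y; rewrite !inE.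
  - by rewrite (opt_radius_rank0 Tct Tt Taug Mk k0) gt0_muley ?leey // lte_fin; lra.
  - rewrite k0 mul0r addr0 add0r; apply: (@le_trans _ _ (2000%:R * 7)).
      by rewrite -natrM ler_nat.
    have z1 : 1 <= ((2 : R) ^+ 2 * (x ^+ 2 + 2)) ^+ 9.
      by rewrite exprn_ege1 //; have := sqr_ge0 x; rewrite [2 ^+ 2]expr2; lra.
    rewrite -mulrA ler_pM2l ?ltr0n //.
    have l0 : 0 <= 2 / ln 2 :> R by rewrite divr_ge0 // ltW.
    by rewrite -[leLHS]mulr1 ler_pM //; lra.
have [D0 dbl _] := dim.
have B1 : 1 <= (2 `^ D) ^+ 2 :> R.
  by rewrite exprn_ege1 // -[leLHS](powRr0 2) ler_powR // ler1n.
have tS : epoint t \in S by rewrite -(subtree_root Tct Tt) subtree_points_self.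
have [m [mstop mx mB]] : exists m,
    [/\ (forall j us, frontier T t j us -> leaves us) \/ 1 <= 2 ^+ m * eps, m%:R <= x &
        ((2 `^ D) ^+ 2) ^+ m <= 1 + x ^+ 2].
  have [tE|tE] := pselect (echildren t = [::]).
    exists 0%N; split; [left=> j us; apply: (leaves_singleton Tct Tt tE)|by []|].
    by rewrite expr0 lerDl exprn_ge0.
  have D1 : 1 <= D.
    have [p [q [_ _ d]]] := start_dist Tct Tt tE.
    apply: (@doubling_dimension_ge1 _ _ _ p q dim).
    by rewrite -mdist_gt0; apply: lt_trans d; apply: exp2_gt0.
  have ex : exists m, 1 <= 2 ^+ m * eps.
    exists (Num.truncn eps^-1).+1; rewrite -ler_pdivrMr // div1r.
    apply: le_trans (ltW (truncnS_gt _)) _; rewrite -natrX ler_nat ltnW //.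
    exact: ltn_expl.
  have [m mP mmin] := ex_minnP ex; exists m; split; [by right| |].
    case: m mP mmin => [//|m] mP mmin.
    have lt1 : 2 ^+ m * eps < 1 by rewrite ltNge; apply/negP => /mmin; rewrite ltnn.
    have le64 : 2 ^+ m.+1 <= 64 / eps.
      by rewrite ler_pdivlMr // exprS; lra.
    apply: (@le_trans _ _ (64 / eps)).
      by apply: le_trans le64; rewrite -natrX ler_nat ltnW // ltn_expl.
    apply: le1r_powR => //; apply: le_trans le64.
    by rewrite exprn_ege1 // ler1n.
  case: m mP mmin => [|m] mP mmin; first by rewrite expr0 lerDl exprn_ge0.
  have lt1 : 2 ^+ m * eps < 1 by rewrite ltNge; apply/negP => /mmin; rewrite ltnn.
  have le64 : 2 ^+ m.+1 <= 64 / eps by rewrite ler_pdivlMr // exprS; lra.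
  have -> : ((2 `^ D) ^+ 2) ^+ m.+1 = ((2 ^+ m.+1) `^ D) ^+ 2.
    rewrite exprAC; congr (_ ^+ 2).
    by rewrite -powR_mulrn ?powR_ge0 // powRAC powR_mulrn.
  apply: (@le_trans _ _ (x ^+ 2)); last by rewrite lerDr.
  rewrite lerXn2r ?nnegrE ?powR_ge0 // ge0_ler_powR // nnegrE ?exprn_ge0 //.
  by rewrite divr_ge0 // ltW.
pose N2 := (Num.truncn (k%:R * (1 + x ^+ 2))).+1.
have y0 : 0 <= k%:R * (1 + x ^+ 2) by rewrite mulr_ge0 // addr_ge0 // exprn_ge0.
have N2lt : k%:R * ((2 `^ D) ^+ 2) ^+ m < N2%:R.
  by apply: le_lt_trans (truncnS_gt _); rewrite ler_wpM2l.
have N2le : N2%:R <= k%:R * (1 + x ^+ 2) + 1.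
  by rewrite -natr1 lerD2r; case/andP: (truncn_itv y0).
have [us1 [us2 [j [i [[n run nle] [fr1 sz1] or1 [fr2 sz2] or2]]]]] :=
  ev_program M Tct Tt k0 tk (size_mis Tct Tt Taug Mk) glv B1
    (fun j us => @size_next_level _ _ _ _ Tct _ _ j us dbl) mstop N2lt.
have A0 : [fset y in emis t] != fset0.
  apply/fset0Pn; case: (emis t) tk k0 => [<- //|y l _ _].
  by exists y; rewrite !inE eqxx.
have [_ iA _] := mA.
have [rho [C [optE iC cov]]] := opt_radius_finite tS iA A0.
have rho0 : 0 <= rho.
  by have [y _ ty] := cov _ tS; apply: le_trans ty; apply: mdist_ge0.
have [d /andP[d0 dle] near] :=
  descent_radius Tct Tt Taug Mk rho0 eps0 iC cov fr1 or1 fr2 or2.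
have [is_ rad] := cluster_radius Tct Tt Taug d0 iC cov fr2 near.
eexists; exists n; split; [exact: run|exact: is_| |].
- rewrite optE -EFinM; apply: le_trans rad _; rewrite lee_fin.
  by rewrite mulrDl; lra.
- apply: (@steps_bound R k g m N2 n x _ k0 x0 L0 mx N2le gL).
  by rewrite -[leqRHS]muln1.
Qed.
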